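(* Assume that $E_{ij}=\sigma\xi_{ij}$ where the $\xi_{ij}$ ($1\le i\le n$, $1\le j\le m_2$) are independent $N(0,1)$ random variables. Let $r=\mathrm{rank}(V)$, let $0<\alpha<1$, $\beta>0$, $0<\rho<1$, put $\gamma=\frac{1+\beta}{1-\alpha}$ and $$\lambda=\frac{(1+\beta)\left(\sqrt{m_2}+\sqrt r\right)}{(1-\alpha)\sqrt{n\,m_2}} .$$ Let $\hat A$ be a minimizer over $A\in\mathbb{R}^{m_1\times m_2}$ of $\|U-VA\|_2+\lambda\|VA\|_1$. Assume that $$\mathrm{rank}(VA_0)\ \le\ \frac{\rho^2\,n\,m_2}{2\gamma^2\left(\sqrt{m_2}+\sqrt r\right)^2} .$$ Then there are constants $c,C>0$, not depending on $n,m_1,m_2,r,\sigma,V,A_0$ (they may depend on the fixed $\alpha,\beta,\rho$), such that with probability at least $1-2\exp\{-c(m_2+r)\}$, $$\|V(\hat A-A_0)\|_2^2\ \le\ C\,\sigma^2(m_2+r)\,\mathrm{rank}(VA_0).$$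
   Context: For a matrix $A$, $\|A\|_1$ is the nuclear norm (sum of singular values) and $\|A\|_2$ the Frobenius norm. Model: $U_i=V_iA_0+E_i$, $i=1,\dots,n$, where $U_i$ are $1\times m_2$ response vectors, $V_i$ are fixed $1\times m_1$ predictor vectors, $A_0\in\mathbb{R}^{m_1\times m_2}$ is unknown, and $E_i=(E_{i1},\dots,E_{im_2})$ are random $1\times m_2$ noise vectors; $\sigma>0$ is the unknown noise standard deviation. Let $V=(V_1^T,\dots,V_n^T)^T\in\mathbb{R}^{n\times m_1}$, $U=(U_1^T,\dots,U_n^T)^T\in\mathbb{R}^{n\times m_2}$, $E=(E_1^T,\dots,E_n^T)^T\in\mathbb{R}^{n\times m_2}$, so that $U=VA_0+E$. *)

(* Defs.v *)
From mathcomp Require Import all_boot all_order all_algebra.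
From mathcomp Require Import all_classical all_reals all_analysis.
From mathcomp Require polyrcf.

Set Implicit Arguments.
Unset Strict Implicit.
Unset Printing Implicit Defensive.

Import Order.TTheory GRing.Theory Num.Theory.

Local Open Scope classical_set_scope.
Local Open Scope ring_scope.

Definition frobenius_norm (R : realType) (m n : nat) (A : 'M[R]_(m, n)) : R :=
  Num.sqrt (\sum_(i < m) \sum_(j < n) A i j ^+ 2).

(* Square roots of the eigenvalues of A^T A, each eigenvalue repeated according
   to its multiplicity. For n > m the list has n - m extra zeros compared with
   the usual list of min(m, n) singular values; they do not change any sum. *)
Definition singular_values (R : realType) (m n : nat) (A : 'M[R]_(m, n)) :
    seq R :=
  let p := char_poly (A^T *m A) in
  flatten [seq nseq (mup x p) (Num.sqrt x) | x <- polyrcf.rootsR p].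

Definition nuclear_norm (R : realType) (m n : nat) (A : 'M[R]_(m, n)) : R :=
  \sum_(s <- singular_values A) s.

Definition mutually_independent (d : measure_display) (T : measurableType d)
    (R : realType) (P : probability T R) (I : finType)
    (X : I -> {RV P >-> R}) : Prop :=
  forall (J : {set I}) (B : I -> set R),
    (forall i, measurable (B i)) ->
    P [set w | forall i, i \in J -> B i (X i w)]
    = (\prod_(i in J) P (X i @^-1` B i))%E.

(* Laws are compared on Borel sets only: the values of pushforwards and of
   integrals on non-measurable sets carry no probabilistic meaning. *)
Definition standard_normal (d : measure_display) (T : measurableType d)
    (R : realType) (P : probability T R) (X : {RV P >-> R}) : Prop :=
  forall B : set R, measurable B ->
    distribution P X B = normal_prob (0 : R) (1 : R) B.

(* Q itself need not be measurable; if it is, this is p <= P Q. *)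
Definition with_probability_at_least (d : measure_display)
    (T : measurableType d) (R : realType) (P : probability T R) (p : R)
    (Q : set T) : Prop :=
  exists F : set T, [/\ measurable F, F `<=` Q & (p%:E <= P F)%E].

(* Main.v *)
(** The crux is an operator norm bound for an r x m standard Gaussian matrix
    with the sharp constant: since lambda is only a factor
    (1 + beta) / (1 - alpha) above (sqrt m2 + sqrt r) / sqrt (n m2), the
    projected noise must have operator norm at most
    (1 + beta) sigma (sqrt m2 + sqrt r) up to an exponentially small
    probability. Instead of a Gaussian comparison inequality we use random
    bidiagonalization. Rotating the columns, by a rotation that depends on the
    first row only, turns that row into (chi_m, 0, ..., 0) and leaves the other
    rows standard Gaussian; then one transposes and repeats. With s = a + b, the
    property [2 u G v^T + b u_0^2 <= s (|u|^2 + |v|^2)] passes from the transpose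
    of the lower rows (with a in place of b) to G as soon as chi_m <= a. A union
    bound over the r + m chi variables suffices, because polynomial prefactors
    are absorbed in the rate. The rotations are products of plane rotations, so
    that only the invariance of the two-dimensional Gaussian law is needed.

    On the event thus obtained, the projected noise has operator norm at most
    eta lambda ||E||_2 with eta < 1, and comparing the objective at the minimizer
    and at A0 (decomposing nuclear norms along the singular vectors of V A0)
    gives the estimate. *)

From HB Require Import structures.
Require Import Defs.
From mathcomp Require Import all_boot all_order all_algebra.
From mathcomp Require Import all_classical all_reals all_analysis.
From mathcomp Require Import measurable_realfun ring lra.
From mathcomp Require polyrcf spectral complex.

Set Implicit Arguments.
Unset Strict Implicit.
Unset Printing Implicit Defensive.

Import Order.TTheory GRing.Theory Num.Theory.

Local Open Scope classical_set_scope.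
Local Open Scope ring_scope.

(** * Spectral theorem and singular value decomposition *)

Section real_spectral.
Import complex.
Variable R : realType.

(** An eigenvalue exists over the complex numbers, and symmetry of the real matrix [S] forces it to
    be real. It is then an eigenvalue over [R] as well, which yields a real eigenvector to
    normalize. *)
Lemma symmetric_eigenvector n (S : 'M[R]_n.+1) : S^T = S ->
  exists (a : R) (v : 'rV[R]_n.+1), v *m S = a *: v /\ (v *m v^T) 0 0 = 1.
Proof.
move=> SS.
pose C : numClosedFieldType := complex R.
pose f : {rmorphism R -> C} := real_complex R.
have [a /eigenvalueP[z zS z0]] := @spectral.eigenvalue_closed C _ (map_mx f S) (ltn0Sn n).
have fconj (x : R) : (f x)^* = f x by rewrite conj_Creal// complex_real.
(* The number [z S z^*] equals [a] times the nonzero real [z z^*]; it is self-conjugate because [S]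
   is real and symmetric. *)
have ar : a^* = a.
  pose zc := map_mx Num.conj z^T.
  have zz0 : (z *m zc) 0 0 != 0.
    rewrite mxE; apply: contra_neq z0 => /eqP.
    rewrite psumr_eq0 => [/allP H|i _]; last by rewrite !mxE mul_conjC_ge0.
    apply/rowP => i; have := H i (mem_index_enum _); rewrite !mxE /= mul_conjC_eq0.
    by move=> /eqP.
  have e1 : (z *m map_mx f S *m zc) 0 0 = a * (z *m zc) 0 0.
    by rewrite zS -scalemxAl mxE.
  have zcT : map_mx Num.conj zc^T = z by apply/matrixP => i j; rewrite !mxE /= conjCK.
  have e2 : ((z *m map_mx f S *m zc) 0 0)^* = (z *m map_mx f S *m zc) 0 0.
    transitivity ((map_mx Num.conj (z *m map_mx f S *m zc)^T) 0 0); first by rewrite !mxE.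
    rewrite !trmx_mul !map_mxM zcT -/zc mulmxA; congr ((_ *m _ *m _) 0 0).
    by apply/matrixP => i j; rewrite !mxE /= fconj -[in RHS]SS mxE.
  have e3 : ((z *m zc) 0 0)^* = (z *m zc) 0 0.
    transitivity ((map_mx Num.conj (z *m zc)^T) 0 0); first by rewrite !mxE.
    by rewrite !trmx_mul !map_mxM zcT -/zc.
  have e4 (x y : C) : (x * y)^* = x^* * y^* by exact: rmorphM.
  by move: e2; rewrite e1 e4 e3 => /(mulIf zz0).
have [a0 aE] : exists a0, a = f a0.
  have /complex_realP[a0 a0E] : a \is Num.real by apply/CrealP.
  by exists a0.
have /eigenvalueP[v vS v0] : eigenvalue S a0.
  rewrite -(eigenvalue_map f); apply/eigenvalueP; exists z => //.
  by rewrite zS aE.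
have vv0 : 0 < (v *m v^T) 0 0.
  rewrite mxE lt_neqAle; apply/andP; split; last first.
    by apply: sumr_ge0 => i _; rewrite mxE -expr2 sqr_ge0.
  rewrite eq_sym; apply: contra_neq v0 => /eqP.
  rewrite psumr_eq0 => [/allP H0|i _]; last by rewrite !mxE -expr2 sqr_ge0.
  apply/rowP => i; have := H0 i (mem_index_enum _); rewrite !mxE /= -expr2 sqrf_eq0.
  by move=> /eqP.
exists a0, ((Num.sqrt ((v *m v^T) 0 0))^-1 *: v); split.
  by rewrite -scalemxAl vS !scalerA mulrC.
rewrite linearZ/= -scalemxAl -scalemxAr scalerA mxE -invfM -expr2.
by rewrite sqr_sqrtr ?ltW// mulVf ?gt_eqF.
Qed.

Lemma orthogonal_completion n (v : 'rV[R]_n.+1) : (v *m v^T) 0 0 = 1 ->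
  exists H : 'M[R]_n.+1, H *m H^T = 1%:M /\ row 0 H = v.
Proof.
move=> vv; pose e : 'rV[R]_n.+1 := delta_mx 0 0.
(* [H] is the Householder reflection exchanging [v] and [e]; if [v = e], then
   [k = 2 / 0 = 0] and [H = 1]. *)
have [w wE] : exists w, w = e - v by exists (e - v).
pose k := 2 / (w *m w^T) 0 0.
pose H : 'M[R]_n.+1 := 1%:M - k *: (w^T *m w).
have ee : (e *m e^T) 0 0 = 1 by rewrite trmx_delta mul_delta_mx mxE !eqxx.
have ev : (v *m e^T) 0 0 = (e *m v^T) 0 0.
  by rewrite !mxE; apply: eq_bigr => i _; rewrite !mxE mulrC.
have ww : (w *m w^T) 0 0 = 2 * (e *m w^T) 0 0.
  rewrite wE !linearB/= !mulmxBl.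
  move: ee vv ev; rewrite !mxE; lra.
have HT : H^T = H by rewrite /H linearB/= linearZ/= trmx_mul trmxK trmx1.
exists H; rewrite HT.
have [w0|w0] := eqVneq w 0.
  have -> : H = 1%:M by rewrite /H w0 mulmx0 scaler0 subr0.
  split; first by rewrite mulmx1.
  by rewrite -[v](subKr e) -wE w0 subr0 rowE mulmx1.
have wwn : (w *m w^T) 0 0 != 0.
  rewrite mxE; apply: contra_neq w0 => /eqP.
  rewrite psumr_eq0 => [/allP H0|i _]; last by rewrite !mxE -expr2 sqr_ge0.
  apply/rowP => i; have := H0 i (mem_index_enum _); rewrite !mxE /= -expr2 sqrf_eq0.
  by move=> /eqP.
have wwM : w *m w^T = ((w *m w^T) 0 0)%:M by rewrite [LHS]mx11_scalar.
split.
  rewrite /H mulmxBl mul1mx mulmxBr mulmx1 -scalemxAl -scalemxAr.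
  rewrite mulmxA -(mulmxA w^T w w^T) wwM mul_mx_scalar -scalemxAl !scalerA.
  rewrite -scalerBl -addrA -opprD -scalerDl (_ : k + (k - _) = 0) ?scale0r ?subr0//.
  by rewrite /k; field.
rewrite rowE -/e /H mulmxBr mulmx1 -scalemxAr mulmxA [e *m w^T]mx11_scalar mul_scalar_mx scalerA.
have -> : k * (e *m w^T) 0 0 = 1.
  by rewrite /k ww; field; move: wwn; rewrite ww mulf_eq0 negb_or => /andP[].
by rewrite scale1r wE subKr.
Qed.

(** Completing a unit eigenvector to an orthogonal [H] makes the first row of [H S H^T] a multiple
    of the first basis vector; by symmetry so is the first column, and induction applies to the
    remaining diagonal block. *)
Lemma symmetric_spectral n (S : 'M[R]_n) : S^T = S ->
  exists (Q : 'M[R]_n) (D : 'rV[R]_n), Q *m Q^T = 1%:M /\ S = Q^T *m diag_mx D *m Q.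
Proof.
elim: n S => [|n IH] S SS.
  by exists 1%:M, 0; split; [rewrite trmx1 mulmx1|rewrite [S]thinmx0; apply/matrixP => -[]].
have [a [v [vS vv]]] := symmetric_eigenvector SS.
have [H [HH Hv]] := orthogonal_completion vv.
have HtH : H^T *m H = 1%:M by exact: mulmx1C.
have [S' S'def] : exists S' : 'M[R]_(1 + n), S' = H *m S *m H^T by eexists.
have S'S : S'^T = S' by rewrite S'def !trmx_mul trmxK SS mulmxA.
have r0 : row 0 S' = a *: delta_mx 0 0.
  rewrite S'def !row_mul Hv vS -scalemxAl -Hv -row_mul HH; congr (_ *: _).
  by rewrite rowE mulmx1.
have S'E : S' = block_mx a%:M 0 0 (drsubmx S').
  rewrite -[LHS]submxK; congr block_mx.
  - apply/matrixP => i j; rewrite !ord1 !mxE.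
    have /rowP/(_ 0) := r0; rewrite !mxE eqxx mulr1 /= => <-.
    by congr (S' _ _); apply/val_inj.
  - apply/matrixP => i j; rewrite !ord1 !mxE.
    have /rowP/(_ (rshift 1 j)) := r0; rewrite !mxE.
    by rewrite mulr0 => <-; congr (S' _ _); apply/val_inj.
  - apply/matrixP => i j; rewrite !ord1 !mxE.
    have /rowP/(_ (rshift 1 i)) := r0; rewrite -S'S !mxE.
    by rewrite mulr0 => <-; rewrite -[in RHS]S'S mxE; congr (S' _ _); apply/val_inj.
have [|Q1 [D1 [QQ1 SE1]]] := IH (drsubmx S').
  by rewrite trmx_drsub S'S.
pose B : 'M[R]_(1 + n) := block_mx 1%:M 0 0 Q1.
have BT : B^T = block_mx 1%:M 0 0 Q1^T by rewrite /B tr_block_mx !trmx0 trmx1.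
have BB : B *m B^T = 1%:M.
  rewrite BT /B (mulmx_block 1%:M 0 0 Q1) !mulmx0 !mul0mx mulmx1 !addr0 !add0r QQ1.
  by rewrite -scalar_mx_block.
pose D : 'rV[R]_(1 + n) := row_mx a%:M D1.
have DB : B^T *m diag_mx D *m B = S'.
  rewrite S'E BT /B /D diag_mx_row !mulmx_block !mulmx0 !mul0mx !mul1mx !mulmx1 !addr0 !add0r.
  rewrite SE1 !mul0mx; congr block_mx.
  by apply/matrixP => i j; rewrite !ord1 !mxE.
exists (B *m H), D; split.
  by rewrite trmx_mul mulmxA -(mulmxA B) HH mulmx1.
transitivity (H^T *m S' *m H).
  by rewrite S'def !mulmxA HtH mul1mx -mulmxA HtH mulmx1.
by rewrite -DB trmx_mul !mulmxA.
Qed.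
End real_spectral.

Section svd.
Variable R : realType.

Lemma char_poly_orthogonal n (Q : 'M[R]_n) (D : 'rV[R]_n) : Q *m Q^T = 1%:M ->
  char_poly (Q^T *m diag_mx D *m Q) = \prod_i ('X - (D 0 i)%:P).
Proof.
move=> QQ; have QtQ : Q^T *m Q = 1%:M by exact: mulmx1C.
transitivity (char_poly (diag_mx D)); last first.
  rewrite char_poly_trig ?diag_mx_is_trig//; apply: eq_bigr => i _.
  by rewrite mxE eqxx.
rewrite /char_poly /char_poly_mx.
have -> : 'X%:M - map_mx polyC (Q^T *m diag_mx D *m Q) =
    map_mx polyC Q^T *m ('X%:M - map_mx polyC (diag_mx D)) *m map_mx polyC Q.
  rewrite mulmxBr mulmxBl !map_mxM; congr (_ - _).
  by rewrite mul_mx_scalar -scalemxAl -map_mxM QtQ map_mx1 scalemx1.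
rewrite !det_mulmx mulrC mulrA -det_mulmx -map_mxM QQ map_mx1 det1.
by rewrite mul1r.
Qed.

(** Bridge from [singular_values], defined through roots of the characteristic polynomial, to the
    eigenvalues read off any orthogonal diagonalization: both list the same multiset. *)
Lemma nuclear_norm_spectral n m (A : 'M[R]_(n, m)) (Q : 'M[R]_m) (D : 'rV[R]_m) :
  Q *m Q^T = 1%:M -> A^T *m A = Q^T *m diag_mx D *m Q ->
  nuclear_norm A = \sum_i Num.sqrt (D 0 i).
Proof.
move=> QQ SE; rewrite /nuclear_norm /singular_values SE char_poly_orthogonal//.
set p := \prod_i _.
have pE : p = \prod_(y <- [seq D 0 i | i <- enum 'I_m]) ('X - y%:P).
  by rewrite big_map big_enum.
have p0 : p != 0 by rewrite pE monic_neq0// monic_prod_XsubC.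
have pr x : (x \in polyrcf.rootsR p) = root p x.
  by rewrite -(polyrcf.roots_on_rootsR p0) in_itv.
rewrite big_flatten/= big_map.
set ds := [seq D 0 i | i <- enum 'I_m] in pE.
transitivity (\sum_(y <- ds) Num.sqrt y); last by rewrite big_map big_enum.
(* Grouping equal entries of [ds] gives distinct values with their counts, and the count of a value
   is its multiplicity as a root of [p]. *)
rewrite -[RHS]big_undup_iterop_count (perm_big (undup ds)); last first.
  apply: uniq_perm; [exact: lt_sorted_uniq (polyrcf.sorted_roots _ _ _)|exact: undup_uniq|].
  by move=> x; rewrite pr mem_undup pE root_prod_XsubC.
by apply: eq_bigr => x _; rewrite big_nseq pE mu_prod_XsubC Monoid.iteropE.
Qed.

(** The columns of [B = A Q^T] are orthogonal with squared norms [D]. Those of nonzero norm,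
    normalized, form [X], the matching eigenvectors form [Y], and the others vanish. As [X] factors
    through [A] and has orthonormal columns, their number is at most the rank. *)
Lemma compact_svd n m (A : 'M[R]_(n, m)) :
  exists k (X : 'M[R]_(n, k)) (Y : 'M[R]_(m, k)) (s : 'rV[R]_k),
  [/\ (k <= \rank A)%N, X^T *m X = 1%:M /\ Y^T *m Y = 1%:M, forall i, 0 <= s 0 i,
      A = X *m diag_mx s *m Y^T & nuclear_norm A = \sum_i s 0 i].
Proof.
have [|Q [D [QQ SE]]] := @symmetric_spectral R m (A^T *m A).
  by rewrite trmx_mul trmxK.
have QtQ : Q^T *m Q = 1%:M by exact: mulmx1C.
pose B := A *m Q^T.
have BB : B^T *m B = diag_mx D.
  rewrite /B trmx_mul trmxK mulmxA -(mulmxA Q) SE.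
  by rewrite !mulmxA QQ mul1mx -mulmxA QQ mulmx1.
have DE i : D 0 i = \sum_a B a i ^+ 2.
  have /matrixP/(_ i i) := BB; rewrite !mxE eqxx mulr1n => <-.
  by apply: eq_bigr => a _; rewrite mxE expr2.
have D0 i : 0 <= D 0 i by rewrite DE; apply: sumr_ge0 => a _; exact: sqr_ge0.
pose K := [set i | D 0 i != 0]%SET.
pose f : 'I_#|K| -> 'I_m := enum_val.
have fK a : D 0 (f a) != 0 by have := enum_valP a; rewrite inE.
have fI a b : (f a == f b) = (a == b) by rewrite (inj_eq enum_val_inj).
pose s : 'rV[R]_#|K| := \row_a Num.sqrt (D 0 (f a)).
have s0 a : 0 < s 0 a by rewrite mxE sqrtr_gt0 lt_neqAle eq_sym fK D0.
pose s' : 'rV[R]_#|K| := \row_a (s 0 a)^-1.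
pose Y := colsub f Q^T.
pose X := A *m Y *m diag_mx s'.
have AY : A *m Y = colsub f B.
  by apply/matrixP => i j; rewrite !mxE; apply: eq_bigr => a _; rewrite !mxE.
have XX : X^T *m X = 1%:M.
  apply/matrixP => a b; rewrite /X AY mxE.
  under eq_bigr => i _ do rewrite mxE !mul_mx_diag !mxE.
  transitivity ((s 0 a)^-1 * (s 0 b)^-1 * (B^T *m B) (f a) (f b)).
    rewrite [(B^T *m B) _ _]mxE mulr_sumr; apply: eq_bigr => i _; rewrite !mxE.
    by ring.
  rewrite BB !mxE fI; have [->|_] := eqVneq a b; last by rewrite mulr0.
  rewrite !mulr1n -[D 0 _ in X in _ * X]sqr_sqrtr// expr2.
  have := s0 b; rewrite mxE => sb; field; by rewrite gt_eqF.
have YY : Y^T *m Y = 1%:M.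
  apply/matrixP => a b; rewrite !mxE.
  transitivity ((Q *m Q^T) (f a) (f b)).
    by rewrite mxE; apply: eq_bigr => i _; rewrite !mxE.
  by rewrite QQ mxE fI.
have Xs : X *m diag_mx s = A *m Y.
  apply/matrixP => i j; rewrite /X !mul_mx_diag mxE mxE -mulrA.
  by rewrite [s' 0 j]mxE mulVf ?mulr1// gt_eqF.
exists #|K|, X, Y, s; split => //.
- apply: (@leq_trans (\rank X)); last by rewrite /X -mulmxA mxrankM_maxl.
  by rewrite -[X in (X <= _)%N](mxrank1 R) -XX mxrankM_maxr.
- by move=> i; exact: ltW.
- rewrite Xs AY -[LHS]mulmx1 -QtQ mulmxA -/B.
  apply/matrixP => a b; rewrite !mxE.
  transitivity (\sum_(i in K) B a i * Q i b).
    rewrite [LHS](bigID (mem K))/= [X in _ + X]big1 ?addr0// => i.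
    rewrite inE negbK DE psumr_eq0 => [/allP H|j _]; last exact: sqr_ge0.
    have := H a (mem_index_enum _); rewrite /= sqrf_eq0 => /eqP ->.
    by rewrite mul0r.
  by rewrite big_enum_val; apply: eq_bigr => i _; rewrite !mxE.
rewrite (nuclear_norm_spectral QQ SE) [LHS](bigID (mem K))/= [X in _ + X]big1 ?addr0.
  by rewrite big_enum_val; apply: eq_bigr => i _; rewrite !mxE.
by move=> i; rewrite inE negbK => /eqP ->; rewrite sqrtr0.
Qed.
End svd.

(** * Gaussian measure *)

(** Both sides are measures in [A], so by uniqueness of Lebesgue measure half-open intervals
    suffice. For [a < 0] the preimage is closed at the other end, which does not change its
    length. *)
Lemma lebesgue_measure_affine (R : realType) (a b : R) (A : set R) :
  a != 0 -> measurable A ->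
  (`|a|%:E * lebesgue_measure ((fun y => (a * y + b)%R) @^-1` A))%E = lebesgue_measure A.
Proof.
move=> a0 mA.
pose RR := measurableTypeR R.
have mf : measurable_fun setT (fun y : RR => a * y + b : RR).
  by apply: measurable_funD => //; apply: measurable_funM.
pose f_mixin := isMeasurableFun.Build _ _ _ _ _ mf.
pose f : {mfun _ >-> _} := HB.pack (fun y : RR => a * y + b : RR) f_mixin.
pose k : {nonneg R} := NngNum (normr_ge0 a).
apply/esym.
have := @lebesgue_measure_unique R (mscale k (pushforward lebesgue_measure f)).
apply => // _ [[x y]] _ <-.
rewrite /= /mscale /= /pushforward.
have [a_gt0|a_lt0|/eqP] := ltgtP 0 a; last by rewrite eq_sym (negbTE a0).
  have -> : (fun y => a * y + b) @^-1` [set` `]x, y]] = [set` `](x - b) / a, (y - b) / a] ].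
    apply/seteqP; split => z /=; rewrite !in_itv/= ltr_pdivrMr// ler_pdivlMr//.
    by move=> /andP[? ?]; apply/andP; split; lra.
    by move=> /andP[? ?]; apply/andP; split; lra.
  rewrite !lebesgue_measure_itv/= !lte_fin ltr_pM2r ?invr_gt0// ltrD2r.
  case: ifPn; rewrite ?mule0// => xy.
  by rewrite gtr0_norm// -!EFinB -EFinM; congr EFin; field.
have -> : (fun y => a * y + b) @^-1` [set` `]x, y]] = [set` `[(y - b) / a, (x - b) / a[ ].
  apply/seteqP; split => z /=; rewrite !in_itv/= ltr_ndivlMr// ler_ndivrMr//.
  by move=> /andP[? ?]; apply/andP; split; lra.
  by move=> /andP[? ?]; apply/andP; split; lra.
rewrite !lebesgue_measure_itv/= !lte_fin ltr_nM2r ?invr_lt0// ltrD2r.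
case: ifPn; rewrite ?mule0// => xy.
by rewrite ltr0_norm// -!EFinB -EFinM; congr EFin; field; rewrite a0.
Qed.

Lemma ge0_integral_image d1 d2 (X : measurableType d1) (Y : measurableType d2)
  (R : realType) (phi : X -> Y) (mphi : measurable_fun setT phi)
  (m1 : {measure set X -> \bar R}) (m2 : {measure set Y -> \bar R}) (k : {nonneg R})
  (f : Y -> \bar R) :
  (forall A, measurable A -> m2 A = (k%:num%:E * m1 (phi @^-1` A))%E) ->
  measurable_fun setT f -> (forall y, (0 <= f y)%E) ->
  (\int[m2]_y f y = k%:num%:E * \int[m1]_x f (phi x))%E.
Proof.
move=> m2E mf f0.
have := ge0_integral_pushforward mphi m1 measurableT mf (fun y _ => f0 y).
rewrite preimage_setT => <-.
rewrite -ge0_integral_mscale//.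
by apply: eq_measure_integral => A mA _; rewrite m2E.
Qed.

Lemma ge0_integral_affine (R : realType) (a b : R) (f : measurableTypeR R -> \bar R) :
  a != 0 -> measurable_fun setT f -> (forall x, (0 <= f x)%E) ->
  (\int[lebesgue_measure]_y f y =
   `|a|%:E * \int[lebesgue_measure]_y f (a * y + b)%R)%E.
Proof.
move=> a0 mf f0.
have mh : measurable_fun setT (fun y : measurableTypeR R => a * y + b : measurableTypeR R).
  by apply: measurable_funD => //; apply: measurable_funM.
apply: (ge0_integral_image mh (k := NngNum (normr_ge0 a))) => // A mA.
by rewrite /= lebesgue_measure_affine.
Qed.

Section density.
Import HBNNSimple.

(** The usual extension from indicators through simple functions to monotone limits. *)
Lemma ge0_integral_density d (T : measurableType d) (R : realType)
  (mu nu : {measure set T -> \bar R}) (g : T -> R) :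
  measurable_fun setT g -> (forall x, 0 <= g x) ->
  (forall A, measurable A -> nu A = (\int[mu]_(x in A) (g x)%:E)%E) ->
  forall f : T -> \bar R, measurable_fun setT f -> (forall x, (0 <= f x)%E) ->
  (\int[nu]_x f x = \int[mu]_x (f x * (g x)%:E))%E.
Proof.
move=> mg g0 nuE f mf f0.
have mEg : measurable_fun setT (EFin \o g) by exact/measurable_EFinP.
pose f_ := nnsfun_approx measurableT mf.
have f_f x : EFin (f_ n x) @[n --> \oo] --> f x by exact: cvg_nnsfun_approx.
transitivity (limn (fun n => \int[nu]_x (f_ n x)%:E)%E).
  rewrite -monotone_convergence//.
  - by apply: eq_integral => y _; apply/esym/cvg_lim.
  - by move=> n; exact/measurable_EFinP/measurable_funP.
  - by move=> n y _; rewrite lee_fin.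
  - by move=> y _ m n mn; rewrite lee_fin; exact/lefP/nd_nnsfun_approx.
transitivity (limn (fun n => \int[mu]_x ((f_ n x)%:E * (g x)%:E))%E); last first.
  rewrite -monotone_convergence//.
  - apply: eq_integral => y _; apply/cvg_lim => //.
    apply: cvgeZr => //. 
  - by move=> n; apply: emeasurable_funM => //; exact/measurable_EFinP/measurable_funP.
  - by move=> n y _; rewrite -EFinM lee_fin mulr_ge0.
  - move=> y _ m n mn; rewrite -!EFinM lee_fin ler_wpM2r//.
    exact/lefP/nd_nnsfun_approx.
congr (limn _); apply/funext => n.
transitivity (\sum_(k \in range (f_ n))
    \int[nu]_x (k * \1_(f_ n @^-1` [set k]) x)%:E)%E.
  under eq_integral do rewrite fimfunE -fsumEFin//.
  rewrite ge0_integral_fsum//; last 2 first.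
  - by move=> y; exact/measurable_EFinP/measurable_funM.
  - by move=> y x _; rewrite nnfun_muleindic_ge0.
transitivity (\sum_(k \in range (f_ n))
    \int[mu]_x ((k * \1_(f_ n @^-1` [set k]) x)%:E * (g x)%:E))%E; last first.
  under [RHS]eq_integral => x _.
    rewrite fimfunE -fsumEFin// ge0_mule_fsuml; last first.
      by move=> y; exact: nnfun_muleindic_ge0.
    over.
  rewrite ge0_integral_fsum//; last 2 first.
  - by move=> y; apply: emeasurable_funM => //; exact/measurable_EFinP/measurable_funM.
  - by move=> y x _; rewrite mule_ge0// ?nnfun_muleindic_ge0// lee_fin.
apply: eq_fsbigr => r; rewrite inE => -[x _ <-].
rewrite integralZl_indic_nnsfun// integral_indic//= setIT nuE//.
under [RHS]eq_integral do rewrite EFinM -muleA.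
rewrite ge0_integralZl//.
- congr *%E; rewrite integral_mkcond; apply: eq_integral => y _.
  by rewrite patchE indicE; case: ifPn; rewrite ?mul1e ?mul0e.
- by apply: emeasurable_funM => //; exact/measurable_EFinP.
- by move=> t _; rewrite mule_ge0 ?lee_fin.
- by rewrite lee_fin.
Qed.

End density.

(** One variable is changed at a time: [x] to [u = c x + s y] with [y] fixed, then [y] to
    [v = - s x + c y] with [u] fixed. The two scale factors [|c|] and [1 / |c|] cancel. *)
Lemma ge0_integral_rotation (R : realType) (c s : R)
    (g : measurableTypeR R * measurableTypeR R -> \bar R) :
  c ^+ 2 + s ^+ 2 = 1 -> measurable_fun setT g -> (forall p, (0 <= g p)%E) ->
  let mu := @lebesgue_measure R in
  (\int[mu]_x \int[mu]_y g (c * x + s * y, - s * x + c * y)%R =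
   \int[mu]_x \int[mu]_y g (x, y))%E.
Proof.
move=> cs1 mg g0 mu.
pose RR := measurableTypeR R.
have mlin (a b : R) : measurable_fun setT (fun p : RR * RR => a * p.1 + b * p.2 : RR).
  by apply: measurable_funD; apply: measurable_funM.
have mpair (a1 b1 a2 b2 : R) : measurable_fun setT
    (fun p : RR * RR => g (a1 * p.1 + b1 * p.2, a2 * p.1 + b2 * p.2)).
  by apply: (measurableT_comp mg); exact: measurable_fun_pair.
have sec1 (h : RR * RR -> \bar R) y : measurable_fun setT h -> measurable_fun setT (fun x => h (x, y)).
  by move=> mh; apply: measurableT_comp => //; exact: measurable_pair2.
have sec2 (h : RR * RR -> \bar R) x : measurable_fun setT h -> measurable_fun setT (fun y => h (x, y)).
  by move=> mh; apply: measurableT_comp => //; exact: measurable_pair1.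
transitivity (\int[mu]_y \int[mu]_x g (c * x + s * y, - s * x + c * y)%R)%E.
  exact: (@fubini_tonelli _ _ _ _ _ mu mu (fun p => g (c * p.1 + s * p.2, - s * p.1 + c * p.2)%R)).
(* If [c = 0], the rotation swaps the axes up to signs and the scale factors have modulus 1. *)
have [c0|c0] := eqVneq c 0.
  have s2 : s ^+ 2 = 1 by rewrite -cs1 c0 expr0n add0r.
  have ns1 : `|s| = 1 by apply/eqP; rewrite -sqrp_eq1// real_normK ?num_real// s2.
  have s0 : s != 0 by rewrite -normr_gt0 ns1.
  transitivity (\int[mu]_y \int[mu]_v g (s * y + 0, v)%R)%E.
    apply: eq_integral => y _.
    rewrite (@ge0_integral_affine _ (- s) 0 (fun v => g (s * y + 0, v)))%R ?oppr_eq0//.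
      rewrite normrN ns1 mul1e; apply: eq_integral => x _.
      by rewrite c0 !mul0r add0r !addr0.
    exact: (sec2 g).
  rewrite [RHS](@ge0_integral_affine _ s 0 (fun u => \int[mu]_v g (u, v))%E)//.
  - by rewrite ns1 mul1e.
  - exact: (measurable_fun_fubini_tonelli_F g).
  - by move=> u; apply: integral_ge0.
(* In the coordinates [(u, y)], the relation [c^2 + s^2 = 1] turns [- s x + c y] into
   [- (s / c) u + y / c]. *)
pose h (p : RR * RR) := g (p.1, (- s / c * p.1 + c^-1 * p.2))%R.
have mh : measurable_fun setT h.
  rewrite (_ : h = fun p => g (1 * p.1 + 0 * p.2, (- s / c * p.1 + c^-1 * p.2))%R)//.
  by apply/funext => p; rewrite /h mul1r mul0r addr0.
have h0 p : (0 <= h p)%E by exact: g0.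
have cV0 : `|c^-1| * `|c| = 1 by rewrite -normrM mulVf// normr1.
transitivity (`|c^-1|%:E * \int[mu]_y \int[mu]_u h (u, y))%E.
  rewrite -ge0_integralZl//; last 2 first.
  - exact: (measurable_fun_fubini_tonelli_G h).
  - by move=> x _; apply: integral_ge0 => *; exact: g0.
  apply: eq_integral => y _.
  rewrite (@ge0_integral_affine _ c (s * y) (fun u => h (u, y)))%R//; last exact: (sec1 h).
  rewrite muleA -EFinM cV0 mul1e; apply: eq_integral => x _.
  rewrite /h /=; congr (g (_, _)).
  have -> : (c^-1 * y = c^-1 * (c ^+ 2 + s ^+ 2) * y)%R by rewrite cs1 mulr1.
  by field.
rewrite -(@fubini_tonelli _ _ _ _ _ mu mu h)// -?ge0_integralZl//; last 2 first.
- exact: (measurable_fun_fubini_tonelli_F h).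
- by move=> x _; apply: integral_ge0 => *; exact: g0.
apply: eq_integral => u _.
rewrite (@ge0_integral_affine _ c^-1 (- s / c * u) (fun v => g (u, v)))%R ?invr_eq0//; last first.
  exact: (sec2 g).
by congr *%E; apply: eq_integral => y _; rewrite /h /= addrC.
Qed.

(* [lebesgue_measure] lives on [measurableTypeR R], whose sigma-algebra is
   convertible to, but not syntactically, that of [R]. *)
Definition gauss (R : realType) : set (measurableTypeR R) -> \bar R :=
  @normal_prob R 0 1.
HB.instance Definition _ (R : realType) := Probability.on (@gauss R).

Lemma gauss_density (R : realType) (f : measurableTypeR R -> \bar R) :
  measurable_fun setT f -> (forall x, (0 <= f x)%E) ->
  (\int[@gauss R]_x f x =
   \int[lebesgue_measure]_x (f x * (normal_pdf 0 1 x)%:E))%E.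
Proof.
apply: ge0_integral_density => [|x|//].
  exact: measurable_normal_pdf.
exact: normal_pdf_ge0.
Qed.

(** The product of the two densities depends only on [x^2 + y^2], which the rotation preserves, and
    Lebesgue integrals are invariant by [ge0_integral_rotation]. *)
Lemma gauss_rotation (R : realType) (c s : R) (A B : set (measurableTypeR R)) :
  c ^+ 2 + s ^+ 2 = 1 -> measurable A -> measurable B ->
  ((@gauss R \x @gauss R)
     [set p : measurableTypeR R * measurableTypeR R |
       A (c * p.1 + s * p.2)%R /\ B (- s * p.1 + c * p.2)%R] =
   @gauss R A * @gauss R B)%E.
Proof.
move=> cs1 mA mB.
pose RR := measurableTypeR R.
pose f (x : RR) := normal_pdf (0 : R) 1 x.
have f0 x : 0 <= f x by exact: normal_pdf_ge0.
have mf : measurable_fun setT f by exact: measurable_normal_pdf.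
have mlin (a b : R) : measurable_fun setT (fun p : RR * RR => a * p.1 + b * p.2 : RR).
  by apply: measurable_funD; apply: measurable_funM.
set D := [set p | _].
have mD : measurable D.
  have -> : D = (fun p : RR * RR => c * p.1 + s * p.2 : RR) @^-1` A `&`
                (fun p : RR * RR => - s * p.1 + c * p.2 : RR) @^-1` B by [].
  by apply: measurableI; rewrite -[X in measurable X]setTI; exact: mlin.
pose g (p : RR * RR) : \bar R := ((\1_A p.1 * f p.1) * (\1_B p.2 * f p.2))%:E.
have g0 p : (0 <= g p)%E by rewrite lee_fin !mulr_ge0.
have mg : measurable_fun setT g.
  have m1 := @measurable_indic _ RR R setT A mA; have m2 := @measurable_indic _ RR R setT B mB.
  apply/measurable_EFinP; apply: measurable_funM; apply: measurable_funM.
  - exact: (measurableT_comp m1 measurable_fst).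
  - exact: (measurableT_comp mf measurable_fst).
  - exact: (measurableT_comp m2 measurable_snd).
  - exact: (measurableT_comp mf measurable_snd).
have gaussE (E : set RR) : measurable E -> (@gauss R E = \int[lebesgue_measure]_x (\1_E x * f x)%:E)%E.
  move=> mE; rewrite -[E in LHS]setIT -integral_indic// gauss_density.
  - by apply: eq_integral => x _; rewrite EFinM.
  - by apply/measurable_EFinP/measurable_indic.
  - by move=> x; rewrite lee_fin.
transitivity (\int[lebesgue_measure]_x \int[lebesgue_measure]_y
    g (c * x + s * y, - s * x + c * y)%R)%E; last first.
  rewrite ge0_integral_rotation// (gaussE A)// (gaussE B)//.
  rewrite -ge0_integralZr//; last 3 first.
  - by apply/measurable_EFinP; apply: measurable_funM.
  - by move=> x _; rewrite lee_fin mulr_ge0.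
  - by apply: integral_ge0 => x _; rewrite lee_fin mulr_ge0.
  apply: eq_integral => x _; rewrite -ge0_integralZl//; last 3 first.
  - by apply/measurable_EFinP; apply: measurable_funM.
  - by move=> y _; rewrite lee_fin mulr_ge0.
  - by rewrite lee_fin mulr_ge0.
rewrite /product_measure1 gauss_density; last 2 first.
- exact: measurable_fun_xsection.
- by move=> x /=; exact: measure_ge0.
apply: eq_integral => x _ /=.
rewrite gaussE; last exact: measurable_xsection.
rewrite -ge0_integralZr//; last 3 first.
- by apply/measurable_EFinP; apply: measurable_funM => //; apply: measurable_indic; exact: measurable_xsection.
- by move=> y _; rewrite lee_fin mulr_ge0.
- by rewrite lee_fin f0.
apply: eq_integral => y _; rewrite -EFinM /g /=; congr EFin.
have -> : \1_(xsection D x) y = \1_A (c * x + s * y) * \1_B (- s * x + c * y) :> R.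
  rewrite -[RHS]/((\1_A (c * x + s * y) * \1_B (- s * x + c * y))%R).
  rewrite !indicE mem_xsection.
  have -> : ((x, y) \in D) = (c * x + s * y \in A) && (- s * x + c * y \in B).
    by apply/idP/andP; rewrite !inE.
  by case: (_ \in A); case: (_ \in B); rewrite ?mulr0 ?mulr1.
have ff : f (c * x + s * y) * f (- s * x + c * y) = f y * f x.
  rewrite /f /normal_pdf oner_eq0 /normal_fun /=.
  rewrite mulrACA [RHS]mulrACA -!expRD; congr (_ * expR _).
  rewrite !subr0 -mulrDl -[RHS]mulrDl; congr (_ / _).
  transitivity (- ((c ^+ 2 + s ^+ 2) * (y ^+ 2 + x ^+ 2))); first by ring.
  by rewrite cs1; ring.
by rewrite [RHS]mulrACA ff mulrA.
Qed.

(** * Gaussian families and random rotations *)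

(** Uniqueness of the product measure, applied to [P] restricted to [F]. In the applications [F]
    records conditions on the remaining variables and [k] is their probability; carrying them along
    lets one pair be treated without forming the joint law of the whole family. *)
Lemma joint_law d d1 d2 (T : measurableType d) (S1 : measurableType d1)
    (S2 : measurableType d2) (R : realType) (P : probability T R)
    (X : T -> S1) (Y : T -> S2) (F : set T) (k : {nonneg R})
    (m1 : probability S1 R) (m2 : probability S2 R) :
  measurable_fun setT X -> measurable_fun setT Y -> measurable F ->
  (forall A B, measurable A -> measurable B ->
    P [set w | [/\ A (X w), B (Y w) & F w]] = (k%:num%:E * (m1 A * m2 B))%E) ->
  forall D, measurable D ->
    P [set w | D (X w, Y w) /\ F w] = (k%:num%:E * (m1 \x m2) D)%E.
Proof.
move=> mX mY mF H D mD.
have mXY : measurable_fun setT (fun w => (X w, Y w)) by exact: measurable_fun_pair.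
pose m' := pushforward (mrestr P mF) (fun w => (X w, Y w)).
transitivity (m' D) => //.
have <- : (mscale k m1 \x m2)%E D = m' D.
  apply: product_measure_unique => // A B mA mB.
  rewrite /= /mscale /= -muleA -H// /m' /pushforward /mrestr; congr (P _).
  by apply/seteqP; split => w /=; [move=> [[]]|move=> []].
rewrite /product_measure1 ge0_integral_mscale//.
exact: measurable_fun_xsection.
Qed.

Section gaussian_given.
Context d (T : measurableType d) (R : realType) (P : probability T R).
Local Notation RR := (measurableTypeR R).

(* On measurable rectangles: the [X i], [i \in J], are i.i.d. N(0, 1) and
   independent of the random element [Z]. *)
Definition gaussian_given d' (S : measurableType d') (Z : T -> S) (I : finType)
    (J : {set I}) (X : I -> T -> RR) : Prop :=
  [/\ measurable_fun setT Z, forall i, i \in J -> measurable_fun setT (X i) &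
  forall (D : set S) (B : I -> set RR), measurable D -> (forall i, measurable (B i)) ->
    P [set w | D (Z w) /\ forall i, i \in J -> B i (X i w)] =
    (P (Z @^-1` D) * \prod_(i in J) gauss (B i))%E ].

Lemma measurable_family (I : finType) (J : {set I}) (X : I -> T -> RR) (B : I -> set RR) :
  (forall i, i \in J -> measurable_fun setT (X i)) -> (forall i, measurable (B i)) ->
  measurable [set w | forall i, i \in J -> B i (X i w)].
Proof.
move=> mX mB.
rewrite (_ : [set w | _] = \bigcap_(i in [set i | i \in J]) (X i @^-1` B i)).
  apply: fin_bigcap_measurable; first exact: finite_finset.
  by move=> i iJ; rewrite -[X in measurable X]setTI; exact: mX.
by apply/seteqP; split => w /= h i; exact: h.
Qed.

Lemma gaussian_given_subset d' (S : measurableType d') (Z : T -> S) (I : finType)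
    (J J' : {set I}) (X : I -> T -> RR) :
  J' \subset J -> gaussian_given Z J X -> gaussian_given Z J' X.
Proof.
move=> /fintype.subsetP J'J [mZ mX H]; split => // [i iJ'|D B mD mB].
  by apply: mX; exact: J'J.
have := H D (fun i => if i \in J' then B i else setT) mD.
rewrite (eq_bigr (fun i => if i \in J' then gauss (B i) else 1%E)); last first.
  by move=> i _; case: ifP => // _; exact: probability_setT.
rewrite -big_mkcondr/= (eq_bigl (fun i => i \in J')); last first.
  by move=> i; apply/andP/idP => [[]//|iJ']; split => //; exact: J'J.
move=> <-; last by move=> i; case: ifP.
congr (P _); apply/seteqP; split => w /= [Dw h]; split => // i iJ; last first.
  by have := h i (J'J _ iJ); rewrite iJ.
by case: ifP => // iJ'; exact: h.
Qed.

Lemma gaussian_given_reindex d' (S : measurableType d') (Z : T -> S) (I I' : finType)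
    (f : I' -> I) (J : {set I'}) (X : I -> T -> RR) :
  injective f -> gaussian_given Z (f @: J) X -> gaussian_given Z J (X \o f).
Proof.
move=> fI [mZ mX H]; split => // [i iJ|D B mD mB].
  by apply: mX; exact: imset_f.
pose B' i := if [pick i' | f i' == i] is Some i' then B i' else setT.
have B'f i : B' (f i) = B i.
  by rewrite /B'; case: pickP => [i' /eqP/fI->//|/(_ i)]; rewrite eqxx.
have := H D B' mD; rewrite big_imset/=; last by move=> x y _ _; exact: fI.
under eq_bigr do rewrite B'f.
move=> <-; last by move=> i; rewrite /B'; case: pickP.
congr (P _); apply/seteqP; split => w /= [Dw h]; split => // i.
  by move=> /imsetP[j jJ ->]; rewrite B'f; exact: h.
by move=> iJ; rewrite -B'f; apply: h; exact: imset_f.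
Qed.

Lemma gauss_prod_num (I : finType) (J : {set I}) (B : I -> set RR) :
  (forall i, measurable (B i)) ->
  exists k : {nonneg R}, (\prod_(i in J) gauss (B i))%E = k%:num%:E.
Proof.
move=> mB; rewrite (eq_bigr (fun i => (fine (gauss (B i)))%:E)); last first.
  by move=> i _; rewrite fineK// fin_num_measure.
rewrite prodEFin.
have h : 0 <= \prod_(i in J) fine (gauss (B i)).
  by apply: prodr_ge0 => i _; rewrite fine_ge0.
by exists (NngNum h).
Qed.

(** Revealing [X a]: it becomes part of the conditioning element, so that later rotations may depend
    on it. *)
Lemma gaussian_given_absorb d' (S : measurableType d') (Z : T -> S) (I : finType)
    (a : I) (J : {set I}) (X : I -> T -> RR) :
  a \notin J -> gaussian_given Z (a |: J) X ->
  gaussian_given (fun w => (Z w, X a w)) J X.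
Proof.
move=> aJ GZ; have [mZ mX H] := GZ.
have mXa : measurable_fun setT (X a) by apply: mX; rewrite setU11.
split => [|i iJ|D B mD mB]; first exact: measurable_fun_pair.
  by apply: mX; rewrite setU1r.
have [k kE] := gauss_prod_num J mB.
pose m1 := distribution P (mfun_Sub (mem_set mZ) : {RV P >-> S}).
pose F B := [set w | forall i, i \in J -> B i (X i w)].
have mF B' : (forall i, measurable (B' i)) -> measurable (F B').
  by move=> mB'; apply: measurable_family => // i iJ; apply: mX; rewrite setU1r.
(* Used twice: with [B], and with every set replaced by [setT] and factor 1. The second use
   identifies the product measure of [D] with the probability that the enlarged element lies in
   [D]. *)
have law (B' : I -> set RR) (k' : {nonneg R}) : (forall i, measurable (B' i)) ->
    (\prod_(i in J) gauss (B' i))%E = k'%:num%:E ->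
    P [set w | D (Z w, X a w) /\ F B' w] = (k'%:num%:E * (m1 \x @gauss R) D)%E.
  move=> mB' k'E; apply: joint_law => //; first exact: mF.
  move=> A C mA mC.
  have := H A (fun i => if i == a then C else B' i) mA.
  rewrite big_setU1//= eqxx (eq_bigr (fun i => gauss (B' i))); last first.
    by move=> i iJ; case: eqP => // ia; rewrite -ia iJ in aJ.
  rewrite k'E muleA muleC => <-; last by move=> i; case: ifP.
  congr (P _); apply/seteqP; split => w /=.
    move=> [Aw Cw Fw]; split => // i; rewrite in_setU1 => /orP[/eqP->|iJ].
      by rewrite eqxx.
    by case: eqP => [ia|_]; [rewrite -ia iJ in aJ|exact: Fw].
  move=> [Aw h]; split => //; first by have := h a (setU11 _ _); rewrite eqxx.
  move=> i iJ; have := h i (setU1r _ iJ).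
  by case: eqP => // ia; rewrite -ia iJ in aJ.
rewrite kE (law B k)//.
have E := law (fun=> setT) 1%:nng (fun=> measurableT).
rewrite big1 in E; last by move=> i _; exact: probability_setT.
rewrite muleC -[X in (X * _)%E]mul1e -E//; congr (P _ * _)%E.
by apply/seteqP; split => w //= [].
Qed.

End gaussian_given.

Section rotation.
Context d (T : measurableType d) (R : realType) (P : probability T R).
Local Notation RR := (measurableTypeR R).

Definition rotate_pair (I : finType) (i j : I) (c s : T -> RR) (X : I -> T -> RR) : I -> T -> RR :=
  fun a w => if a == i then c w * X i w + s w * X j w
             else if a == j then - s w * X i w + c w * X j w else X a w.

(** For a fixed value [z] of [Z] this is [gauss_rotation]. Since [Z] is independent of the pair,
    their joint law is a product, and integrating over [z] lets the angle depend on [Z]. *)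
Lemma gaussian_given_rotate d' (S : measurableType d') (Z : T -> S) (I : finType)
    (i j : I) (J : {set I}) (X : I -> T -> RR) (c s : S -> RR) :
  i \in J -> j \in J -> i != j -> measurable_fun setT c -> measurable_fun setT s ->
  (forall z, c z ^+ 2 + s z ^+ 2 = 1) -> gaussian_given P Z J X ->
  gaussian_given P Z J (rotate_pair i j (c \o Z) (s \o Z) X).
Proof.
move=> iJ jJ ij mc ms cs1 [mZ mX H].
have mcZ : measurable_fun setT (c \o Z) by exact: measurableT_comp.
have msZ : measurable_fun setT (s \o Z) by exact: measurableT_comp.
have mXi := mX _ iJ; have mXj := mX _ jJ.
split => // [a aJ|D B mD mB].
  rewrite /rotate_pair; case: eqP => _; last case: eqP => _; last exact: mX.
    by apply: measurable_funD; apply: measurable_funM.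
  apply: measurable_funD; apply: measurable_funM => //; exact: measurableT_comp.
pose J' := J :\ i :\ j.
have J'J a : a \in J' -> a \in J by rewrite !inE => /andP[_ /andP[]].
pose F := [set w | forall a, a \in J' -> B a (X a w)].
have mF : measurable F by apply: measurable_family => // a /J'J; exact: mX.
have [k kE] := gauss_prod_num J' mB.
have splitJ (G : I -> \bar R) :
    (\prod_(a in J) G a = G i * (G j * \prod_(a in J') G a))%E.
  by rewrite (big_setD1 i)//= (big_setD1 j)//= !inE eq_sym ij.
pose m1 := distribution P (mfun_Sub (mem_set mZ) : {RV P >-> S}).
have law0 A E : measurable A -> measurable E ->
    P [set w | [/\ A (Z w), E (X i w, X j w) & F w]] =
    (k%:num%:E * (m1 A * (@gauss R \x @gauss R) E))%E.
  move=> mA mE.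
  have mZA : measurable (Z @^-1` A) by rewrite -[X in measurable X]setTI; exact: (mZ measurableT _ mA).
  have fA : 0 <= fine (P (Z @^-1` A)) by rewrite fine_ge0.
  have kA : (P (Z @^-1` A) = (NngNum fA)%:num%:E)%E by rewrite /= fineK// fin_num_measure.
  have h : 0 <= k%:num * fine (P (Z @^-1` A)) by rewrite mulr_ge0.
  have := @joint_law _ _ _ T RR RR R P (X i) (X j) (Z @^-1` A `&` F) (NngNum h) (@gauss R) (@gauss R)
    mXi mXj (measurableI _ _ mZA mF) _ E mE.
  rewrite /= EFinM -muleA -kA => <-.
    by congr (P _); apply/seteqP; split => w /=; [move=> []|move=> [? []]].
  move=> C1 C2 mC1 mC2.
  have := H A (fun a => if a == i then C1 else if a == j then C2 else B a) mA.
  rewrite splitJ eqxx eqxx [j == i]eq_sym (negbTE ij).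
  rewrite (eq_bigr (fun a => gauss (B a))); last first.
    by move=> a; rewrite !inE => /andP[/negbTE-> /andP[/negbTE->]].
  rewrite kE => Hk.
  rewrite [X in (X * _)%E]muleC -muleA [(k%:num%:E * _)%E]muleC -[(_ * k%:num%:E)%E]muleA.
  rewrite -Hk; last by move=> a; case: ifP => // _; case: ifP.
  congr (P _); apply/seteqP; split => w /=.
    move=> [C1w C2w [Aw Fw]]; split => // a aJ.
    case: eqP => [->//|/eqP ai]; case: eqP => [->//|/eqP aj].
    by apply: Fw; rewrite !inE ai aj.
  move=> [Aw h']; split.
  - by have := h' i iJ; rewrite eqxx.
  - by have := h' j jJ; rewrite eqxx eq_sym (negbTE ij).
  - split => // a aJ; have := h' a (J'J _ aJ).
    by move: aJ; rewrite !inE => /andP[/negbTE-> /andP[/negbTE->]].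
(* [D'] is the event for the rotated pair, pulled back to the original pair; its section at [z] is a
   rotated rectangle if [D z] holds and is empty otherwise. *)
pose D' := [set p : S * (RR * RR) | [/\ D p.1,
   B i (c p.1 * p.2.1 + s p.1 * p.2.2) & B j (- s p.1 * p.2.1 + c p.1 * p.2.2)]].
have mc1 : measurable_fun setT (fun p : S * (RR * RR) => c p.1 : RR).
  exact: (measurableT_comp mc measurable_fst).
have ms1 : measurable_fun setT (fun p : S * (RR * RR) => s p.1 : RR).
  exact: (measurableT_comp ms measurable_fst).
have m21 : measurable_fun setT (fun p : S * (RR * RR) => p.2.1 : RR).
  exact: (measurableT_comp measurable_fst measurable_snd).
have m22 : measurable_fun setT (fun p : S * (RR * RR) => p.2.2 : RR).
  exact: (measurableT_comp measurable_snd measurable_snd).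
have mD' : measurable D'.
  have -> : D' = (fst @^-1` D) `&`
     ((fun p : S * (RR * RR) => c p.1 * p.2.1 + s p.1 * p.2.2 : RR) @^-1` B i `&`
      (fun p : S * (RR * RR) => - s p.1 * p.2.1 + c p.1 * p.2.2 : RR) @^-1` B j).
    by apply/seteqP; split => p /=; [move=> []|move=> [? []]].
  apply: measurableI; first by rewrite -[X in measurable X]setTI; exact: measurable_fst.
  apply: measurableI; rewrite -[X in measurable X]setTI.
    suff : measurable_fun setT (fun p : S * (RR * RR) => c p.1 * p.2.1 + s p.1 * p.2.2 : RR) by exact.
    by apply: measurable_funD; apply: measurable_funM.
  suff : measurable_fun setT (fun p : S * (RR * RR) => - s p.1 * p.2.1 + c p.1 * p.2.2 : RR) by exact.
  by apply: measurable_funD; apply: measurable_funM => //; exact: measurableT_comp.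
have mXij : measurable_fun setT (fun w => (X i w, X j w)) by exact: measurable_fun_pair.
transitivity (P [set w | D' (Z w, (X i w, X j w)) /\ F w]).
  congr (P _); apply/seteqP; split => w /=.
    move=> [Dw h]; split; first split => //=.
    - by have := h i iJ; rewrite /rotate_pair eqxx.
    - by have := h j jJ; rewrite /rotate_pair eqxx eq_sym (negbTE ij).
    - move=> a aJ; have := h a (J'J _ aJ); rewrite /rotate_pair.
      by move: aJ; rewrite !inE => /andP[/negbTE-> /andP[/negbTE->]].
  move=> [[Dw Biw Bjw] Fw]; split => // a aJ; rewrite /rotate_pair.
  case: eqP => [->//|/eqP ai]; case: eqP => [->//|/eqP aj].
  by apply: Fw; rewrite !inE ai aj.
rewrite (joint_law mZ mXij mF law0 mD') splitJ kE.
transitivity (k%:num%:E * (P (Z @^-1` D) * (gauss (B i) * gauss (B j))))%E; last first.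
  by rewrite muleC -!muleA.
congr (_ * _)%E.
transitivity (\int[m1]_z ((gauss (B i) * gauss (B j)) * (\1_D z)%:E))%E.
  apply: eq_integral => z _ /=.
  have [Dz|Dz] := pselect (D z).
    rewrite indicE mem_set// mule1 -[RHS](gauss_rotation (cs1 z) (mB i) (mB j)).
    congr (_ _).
    apply/seteqP; split => p; rewrite /xsection /= inE /D'/= => -[] //.
  rewrite indicE memNset// mule0 (_ : xsection _ _ = set0) ?measure0//.
  by apply/seteqP; split => p //; rewrite /xsection /= inE /D'/= => -[].
rewrite ge0_integralZl//; last 2 first.
- by apply/measurable_EFinP/measurable_indic.
- by rewrite mule_ge0 ?measure_ge0.
by rewrite integral_indic// setIT muleC.
Qed.

End rotation.

(** * Plane rotations and the measurable LQ factorization *)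

Section givens.
Variable R : realType.

(** Multiplication on the right performs [rotate_pair] on the entries [i] and [j] of each row. *)
Definition givens (q : nat) (i j : 'I_q) (c s : R) : 'M[R]_q :=
  \matrix_(a, b) (if b == i then (if a == i then c else if a == j then s else 0)
    else if b == j then (if a == i then - s else if a == j then c else 0)
    else (a == b)%:R).

Lemma mul_givensE p q (A : 'M[R]_(p, q)) (i j : 'I_q) (c s : R) k b : i != j ->
  (A *m givens i j c s) k b =
  if b == i then c * A k i + s * A k j
  else if b == j then - s * A k i + c * A k j else A k b.
Proof.
move=> ij; rewrite mxE; under eq_bigr do rewrite mxE.
have [_|bi] := eqVneq b i.
  rewrite (bigD1 i)//= (bigD1 j)/= 1?eq_sym// eqxx eq_sym (negbTE ij) eqxx.
  rewrite big1 ?addr0 1?mulrC 1?[A k j * _]mulrC// => a /andP[/negbTE-> /negbTE->].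
  by rewrite mulr0.
have [_|bj] := eqVneq b j.
  rewrite (bigD1 i)//= (bigD1 j)/= 1?eq_sym// eqxx eq_sym (negbTE ij) eqxx.
  rewrite big1 ?addr0 1?mulrC 1?[A k j * _]mulrC// => a /andP[/negbTE-> /negbTE->].
  by rewrite mulr0.
rewrite (bigD1 b)//= eqxx mulr1 big1 ?addr0// => a /negbTE->.
by rewrite mulr0.
Qed.

Lemma givens_orthogonal q (i j : 'I_q) (c s : R) : i != j -> c ^+ 2 + s ^+ 2 = 1 ->
  givens i j c s *m (givens i j c s)^T = 1%:M.
Proof.
move=> ij cs1; apply: mulmx1C; apply/matrixP => a b.
have cs1' : c * c + s * s = 1 by rewrite -!expr2.
have ij' := negbTE ij; have ji' : (j == i) = false by rewrite eq_sym.
rewrite mul_givensE// !mxE ?eqxx ?ij' ?ji'.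
have [ea|ai] := eqVneq a i; have [eb|bi] := eqVneq b i; rewrite ?ea ?eb ?eqxx ?ij' ?ji'.
- by [].
- have [eb|bj] := eqVneq b j; first by rewrite eb ij' mulr0n; ring.
  by rewrite eq_sym (negbTE bi).
- have [ea|aj] := eqVneq a j; first by rewrite ea ji' mulr0n; ring.
  by rewrite ?[j == a]eq_sym ?(negbTE aj) ?(negbTE ai) ?mulr0n !mulr0 addr0.
have [ea|aj] := eqVneq a j; have [eb|bj] := eqVneq b j; rewrite ?ea ?eb ?eqxx.
- by transitivity (c * c + s * s); [ring|exact: cs1'].
- by rewrite eq_sym (negbTE bj).
- by rewrite ?[j == a]eq_sym ?(negbTE aj) ?mulr0n !mulr0 addr0.
- by rewrite eq_sym.
Qed.

End givens.

Section random_LQ.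
Context d (T : measurableType d) (R : realType) (P : probability T R).
Context d' (S : measurableType d') (Z : T -> S).
Local Notation RR := (measurableTypeR R).

Definition gaussian_matrix p q (G : T -> 'M[R]_(p, q)) : Prop :=
  gaussian_given P Z [set: 'I_p * 'I_q] (fun ij w => G w ij.1 ij.2).

Lemma gaussian_matrix_givens p q (G : T -> 'M[R]_(p, q)) (i j : 'I_q) (c s : S -> RR) :
  i != j -> measurable_fun setT c -> measurable_fun setT s ->
  (forall z, c z ^+ 2 + s z ^+ 2 = 1) -> gaussian_matrix G ->
  gaussian_matrix (fun w => G w *m givens i j (c (Z w)) (s (Z w))).
Proof.
move=> ij mc ms cs1 GG.
(* In [Gk k] only the first [k] rows are rotated; rows are treated one at a time because
   [gaussian_given_rotate] acts on a single pair. *)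
pose Gk (k : nat) (ab : 'I_p * 'I_q) (w : T) : RR :=
  if (ab.1 < k)%N then (G w *m givens i j (c (Z w)) (s (Z w))) ab.1 ab.2
  else G w ab.1 ab.2.
suff : forall k, (k <= p)%N -> gaussian_given P Z [set: 'I_p * 'I_q] (Gk k).
  move=> /(_ p (leqnn p)); rewrite /gaussian_matrix; congr gaussian_given.
  by apply/funext => -[a b]; apply/funext => w; rewrite /Gk /= ltn_ord.
elim=> [|k IH] kp.
  by have -> : Gk 0 = (fun ij w => G w ij.1 ij.2) by apply/funext => ab; apply/funext.
pose ko := Ordinal kp.
have := gaussian_given_rotate (finset.in_setT (ko, i)) (finset.in_setT (ko, j)) _ mc ms cs1 (IH (ltnW kp)).
rewrite xpair_eqE eqxx ij => /(_ isT).
congr gaussian_given; apply/funext => -[a b]; apply/funext => w.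
rewrite /rotate_pair /Gk /= !xpair_eqE ltnn.
have -> : (a < k.+1)%N = (a == ko) || (a < k)%N by rewrite ltnS leq_eqVlt -val_eqE.
by have [->|ak] := eqVneq a ko; rewrite /= ?mul_givensE // ltnn.
Qed.

(** The rotations that triangularize [W (Z w)] depend on [Z] alone, and measurably, so each of them
    keeps [G] standard Gaussian given [Z]. *)
Lemma random_LQ r p q (W : S -> 'M[R]_(r, q)) (G : T -> 'M[R]_(p, q)) :
  (forall i j, measurable_fun setT (fun z => W z i j : RR)) ->
  gaussian_matrix G ->
  exists Q : S -> 'M[R]_q, [/\ forall z, Q z *m (Q z)^T = 1%:M,
    forall z (i : 'I_r) (j : 'I_q), (i < j)%N -> (W z *m Q z) i j = 0 &
    gaussian_matrix (fun w => G w *m Q (Z w))].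
Proof.
move=> mW GG.
(* Progress of the elimination: the part above the diagonal is cleared row by row, with [k] rows
   done and row [k] done up to column [j0]. *)
pose Inv (k j0 : nat) (W : 'M[R]_(r, q)) :=
  forall (i : 'I_r) (j : 'I_q), (i < j)%N -> (i < k)%N || (i == k :> nat) && (j < j0)%N -> W i j = 0.
pose Pr k j0 := exists Q : S -> 'M[R]_q, [/\ forall z, Q z *m (Q z)^T = 1%:M,
  forall i j, measurable_fun setT (fun z => (W z *m Q z) i j : RR),
  forall z, Inv k j0 (W z *m Q z) & gaussian_matrix (fun w => G w *m Q (Z w))].
suff : Pr r 0%N.
  move=> [Q [QQ mQ QInv GQ]]; exists Q; split => // z i j ij.
  by apply: (QInv z i j ij); rewrite ltn_ord.
have step k j0 : (k < r)%N -> (j0 < q)%N -> Pr k j0 -> Pr k j0.+1.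
  move=> kr j0q [Q [QQ mQ QInv GQ]].
  (* If [j0 <= k], the entry is not above the diagonal and nothing has to be cleared. *)
  have [j0k|kj0] := leqP j0 k.
    exists Q; split => // z i j ij /orP[ik|/andP[/eqP ik jj0]]; apply: (QInv z i j ij).
      by rewrite ik.
    by move: ij; rewrite ik ltnNge (leq_trans _ j0k).
  pose kR := Ordinal kr; pose kC := Ordinal (ltn_trans kj0 j0q); pose jC := Ordinal j0q.
  have kjC : kC != jC by rewrite -val_eqE /= neq_ltn kj0.
  pose a z := (W z *m Q z) kR kC; pose b z := (W z *m Q z) kR jC.
  pose y z := a z ^+ 2 + b z ^+ 2.
  (* Inverse length as a real power, a measurable function of [y]; where [y = 0] the rotation
     defaults to the identity. *)
  pose h z := y z `^ (- 2^-1).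
  have ma : measurable_fun setT (a : S -> RR) by exact: mQ.
  have mb : measurable_fun setT (b : S -> RR) by exact: mQ.
  have my : measurable_fun setT (y : S -> RR) by apply: measurable_funD; exact: measurable_funX.
  have mh : measurable_fun setT (h : S -> RR) by exact: (measurableT_comp (measurable_powR _) my).
  have hy z : y z != 0 -> y z * h z ^+ 2 = 1.
    move=> y0; rewrite /h -powR_mulrn ?powR_ge0// -powRrM mulNr mulVf ?pnatr_eq0//.
    by rewrite powR_inv1 ?divff// addr_ge0 ?sqr_ge0.
  have y0 z : y z = 0 -> a z = 0 /\ b z = 0.
    move=> /eqP; rewrite paddr_eq0 ?sqr_ge0// !sqrf_eq0 => /andP[/eqP-> /eqP->].
    by [].
  pose c z := if y z == 0 then 1 else a z * h z.
  pose s z := if y z == 0 then 0 else b z * h z.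
  have mc : measurable_fun setT (c : S -> RR).
    apply: measurable_fun_ifT => //; first exact: measurable_fun_eqr.
    exact: measurable_funM.
  have ms : measurable_fun setT (s : S -> RR).
    apply: measurable_fun_ifT => //; first exact: measurable_fun_eqr.
    exact: measurable_funM.
  have cs1 z : c z ^+ 2 + s z ^+ 2 = 1.
    rewrite /c /s; case: eqP => [_|/eqP yz]; first by rewrite expr1n expr0n addr0.
    by rewrite -(hy z yz) /y; ring.
  have scb z : - s z * a z + c z * b z = 0.
    rewrite /c /s; case: eqP => [/y0[-> ->]|_]; first by ring.
    by ring.
  exists (fun z => Q z *m givens kC jC (c z) (s z)); split.
  - move=> z; rewrite trmx_mul mulmxA -(mulmxA (Q z)) givens_orthogonal//.
    by rewrite mulmx1.
  - move=> i j; rewrite (_ : (fun z => _) = fun z =>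
      if j == kC then c z * (W z *m Q z) i kC + s z * (W z *m Q z) i jC
      else if j == jC then - s z * (W z *m Q z) i kC + c z * (W z *m Q z) i jC
      else (W z *m Q z) i j); last first.
      by apply/funext => z; rewrite mulmxA mul_givensE.
    have [_|_] := eqVneq j kC; first by apply: measurable_funD; apply: measurable_funM => //; exact: mQ.
    have [_|_] := eqVneq j jC; last exact: mQ.
    apply: measurable_funD; apply: measurable_funM => //; try exact: mQ.
    exact: measurableT_comp.
  - move=> z i j ij H; rewrite mulmxA mul_givensE//.
    have [ikr|ik] := eqVneq i kR.
      have jk : j != kC by rewrite -val_eqE /= neq_ltn; move: ij; rewrite ikr /= => ->; rewrite orbT.
      rewrite (negbTE jk); have [_|jj] := eqVneq j jC; first by rewrite ikr scb.
      apply: (QInv z i j ij); move: H; rewrite ikr /= ltnn eqxx /= ltnS leq_eqVlt.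
      by rewrite -val_eqE /= in jj; rewrite (negbTE jj).
    have ik' : (i < k)%N.
      by move: H; rewrite -val_eqE /= in ik; rewrite (negbTE ik) orbF.
    (* Finished rows are zero in both rotated columns, whose indices exceed [i], so the rotation
       does not spoil them. *)
    have zi (j' : 'I_q) : (k <= j')%N -> (W z *m Q z) i j' = 0.
      by move=> kj'; apply: (QInv z i j'); [exact: leq_trans kj'|rewrite ik'].
    have [_|jk] := eqVneq j kC; first by rewrite !zi ?mulr0 ?addr0//= ltnW.
    have [_|jj] := eqVneq j jC; first by rewrite !zi ?mulr0 ?addr0//= ltnW.
    by apply: (QInv z i j ij); rewrite ik'.
  - have := gaussian_matrix_givens kjC mc ms cs1 GQ.
    by under eq_fun do rewrite -mulmxA.
have row k : (k < r)%N -> Pr k 0%N -> Pr k.+1 0%N.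
  move=> kr Pk0; have : forall j0, (j0 <= q)%N -> Pr k j0.
    by elim=> // j0 IH j0q; apply: step => //; apply: IH; exact: ltnW.
  move=> /(_ q (leqnn q))[Q [QQ mQ QInv GQ]]; exists Q; split => // z i j ij.
  rewrite ltn0 andbF orbF ltnS leq_eqVlt => /orP[ik|ik]; apply: (QInv z i j ij).
    by rewrite ik ltn_ord orbT.
  by rewrite ik.
have : forall k, (k <= r)%N -> Pr k 0%N.
  elim=> [_|k IH kr]; last by apply: row => //; apply: IH; exact: ltnW.
  exists (fun=> 1%:M); split.
  - by move=> z; rewrite trmx1 mulmx1.
  - by move=> i j; under eq_fun do rewrite mulmx1; exact: mW.
  - by move=> z i j ij; rewrite !ltn0 andbF.
  - by under eq_fun do rewrite mulmx1.
by apply.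
Qed.
End random_LQ.

(** * Tails of chi-square variables *)

Section chi2.
Context d (T : measurableType d) (R : realType) (P : probability T R).
Local Notation RR := (measurableTypeR R).

(** Iterates [gaussian_given_absorb]. The element [Z1] is an iterated pair whose type depends on
    [K]; what is recorded is that [Z] and the absorbed variables are measurable functions of it. *)
Lemma gaussian_given_absorb_set d' (S : measurableType d') (Z : T -> S) (I : finType)
    (K J : {set I}) (X : I -> T -> RR) :
  [disjoint K & J]%B -> gaussian_given P Z (K :|: J) X ->
  exists d1 (S1 : measurableType d1) (Z1 : T -> S1) (g : S1 -> S),
    [/\ gaussian_given P Z1 J X, measurable_fun setT g, Z = g \o Z1 &
        forall k, k \in K -> exists f : S1 -> RR, measurable_fun setT f /\ X k = f \o Z1].
Proof.
elim: {K}_.+1 {-2}K (ltnSn #|K|) => // n IH K Kn in d' S Z *.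
have [->|[a aK]] := finset.set_0Vmem K.
  rewrite finset.set0U => _ GZ; exists d', S, Z, idfun; split => //; [exact: measurable_id|by move=> k; rewrite finset.in_set0].
move=> KJ GZ.
have aJ : a \notin (K :\ a) :|: J.
  by rewrite finset.in_setU finset.in_setD1 eqxx /= (disjointFr KJ aK).
have E : K :|: J = a |: ((K :\ a) :|: J) by rewrite finset.setUA finset.setD1K.
rewrite E in GZ.
have := IH (K :\ a) _ _ _ _ _ (gaussian_given_absorb aJ GZ).
case.
- by rewrite (cardsD1 a K) aK in Kn.
- by apply: disjointWl KJ; exact: finset.subD1set.
move=> d1 [S1 [Z1 [g [G1 mg gZ Xf]]]].
exists d1, S1, Z1, (fst \o g); split => //.
- exact: (measurableT_comp measurable_fst mg).
- by apply/funext => w; have /= <- := congr1 (fun h => h w) gZ.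
move=> k kK; have [->|ka] := eqVneq k a; last by apply: Xf; rewrite !inE ka.
exists (snd \o g); split; first exact: (measurableT_comp measurable_snd mg).
by apply/funext => w; have /= <- := congr1 (fun h => h w) gZ.
Qed.

Lemma gaussian_given_integral d' (S : measurableType d') (Z : T -> S) (I : finType)
    (J : {set I}) (X : I -> T -> RR) (a : I) (f : S -> \bar R) (g : RR -> \bar R) :
  a \in J -> gaussian_given P Z J X ->
  measurable_fun setT f -> measurable_fun setT g ->
  (forall z, (0 <= f z)%E) -> (forall x, (0 <= g x)%E) ->
  (\int[P]_w (f (Z w) * g (X a w)) = \int[P]_w f (Z w) * \int[@gauss R]_x g x)%E.
Proof.
move=> aJ GJ mf mg f0 g0.
have [mZ mX H] : gaussian_given P Z [set a]%SET X.
  by apply: gaussian_given_subset GJ; rewrite finset.sub1set.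
have mXa : measurable_fun setT (X a) by apply: mX; rewrite inE.
pose m1 := distribution P (mfun_Sub (mem_set mZ) : {RV P >-> S}).
have mZX : measurable_fun setT (fun w => (Z w, X a w)) by exact: measurable_fun_pair.
pose h (p : S * RR) := (f p.1 * g p.2)%E.
have mh : measurable_fun setT h.
  by apply: emeasurable_funM; [exact: (measurableT_comp mf measurable_fst)|
    exact: (measurableT_comp mg measurable_snd)].
have h0 p : (0 <= h p)%E by rewrite mule_ge0.
transitivity (\int[m1 \x @gauss R]_p h p)%E.
  have := ge0_integral_pushforward mZX P measurableT mh (fun y _ => h0 y).
  rewrite preimage_setT => <-.
  apply: eq_measure_integral => D mD _.
  transitivity (P [set w | D (Z w, X a w) /\ setT w]).
    by congr (P _); apply/seteqP; split => w //= [].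
  rewrite (@joint_law _ _ _ _ _ _ _ P Z (X a) setT 1%:nng m1 (@gauss R))// ?mul1e// => A B mA mB.
  have := H A (fun=> B) mA (fun=> mB); rewrite finset.big_set1 mul1e => <-.
  congr (P _); apply/seteqP; split => w /=; last by move=> [Aw /(_ a)]; rewrite inE eqxx => /(_ isT).
  by move=> [Aw Bw _]; split => // i; rewrite inE => /eqP->.
rewrite fubini_tonelli1//.
have -> : (\int[P]_w f (Z w) = \int[m1]_z f z)%E.
  have := ge0_integral_pushforward mZ P measurableT mf (fun y _ => f0 y).
  by rewrite preimage_setT => <-.
rewrite -ge0_integralZr//; last by apply: integral_ge0 => x _; exact: g0.
by apply: eq_integral => z _; rewrite /fubini_F /h /= ge0_integralZl.
Qed.

(** Induction on the size of [J]: all variables but one are absorbed into the conditioning element,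
    and the last one splits off by Fubini. *)
Lemma gaussian_given_integral_prod d' (S : measurableType d') (Z : T -> S) (I : finType)
    (J : {set I}) (X : I -> T -> RR) (h : RR -> R) :
  gaussian_given P Z J X -> measurable_fun setT h -> (forall x, 0 <= h x) ->
  (\int[P]_w (\prod_(a in J) h (X a w))%:E = (\int[@gauss R]_x (h x)%:E) ^+ #|J|)%E.
Proof.
move=> + mh h0; move: {2}#|J| (erefl #|J|) => n.
elim: n => [|n IH] in d' S Z J *.
  move=> J0 _; rewrite J0 expe0; move/eqP: J0; rewrite cards_eq0 => /eqP ->.
  under eq_integral do rewrite big_set0.
  by rewrite integral_cst// mul1e; exact: probability_setT.
move=> Jn GZ; have [J0|[a aJ]] := finset.set_0Vmem J; first by rewrite J0 cards0 in Jn.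
have J'n : #|J :\ a| = n by move: Jn; rewrite (cardsD1 a J) aJ => -[].
have GJ' : gaussian_given P Z (J :\ a) X by exact: gaussian_given_subset (finset.subD1set _ _) GZ.
have := @gaussian_given_absorb_set _ _ Z _ (J :\ a) [set a]%SET X.
rewrite disjoint_sym disjoints1 !inE eqxx => /(_ isT).
rewrite finset.setUC finset.setD1K// => /(_ GZ)[d1 [S1 [Z1 [g [G1 mg gZ Xf]]]]].
have /choice [F FP] : forall k, exists f : S1 -> RR, k \in J :\ a ->
    measurable_fun setT f /\ X k = f \o Z1.
  move=> k; have [kJ|kJ] := boolP (k \in J :\ a); last by exists (fun=> 0).
  by have [f fP] := Xf k kJ; exists f.
pose phi (z : S1) := (\prod_(k in J :\ a) h (F k z))%:E.
transitivity (\int[P]_w (phi (Z1 w) * (h (X a w))%:E))%E.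
  apply: eq_integral => w _; rewrite (big_setD1 a)//= EFinM muleC; congr (_%:E * _)%E.
  by apply: eq_bigr => k kJ; have [_ ->] := FP k kJ.
rewrite (gaussian_given_integral (g := fun x => (h x)%:E) _ G1) ?inE//; last 3 first.
- apply/measurable_EFinP; rewrite /phi.
  under eq_fun do rewrite big_mkcond.
  apply: measurable_prod => k _; case: (boolP (k \in J :\ a)) => // kJ.
  by have [mF _] := FP k kJ; exact: (measurableT_comp mh mF).
- exact/measurable_EFinP.
- by move=> z; rewrite lee_fin prodr_ge0.
rewrite Jn expeS muleC -J'n -(IH _ _ Z (J :\ a))//; congr (_ * _)%E.
apply: eq_integral => w _; congr EFin.
by apply: eq_bigr => k kJ; have [_ ->] := FP k kJ.
Qed.

End chi2.

(** Times the normal density, the integrand becomes [1 / sqrt v] times the density of variance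
    [1 / v], whose integral is 1. *)
Lemma gauss_mgf_sqr (R : realType) (v : R) : 0 < v ->
  (\int[@gauss R]_x (expR ((1 - v) / 2 * x ^+ 2))%:E = ((Num.sqrt v)^-1)%:E)%E.
Proof.
move=> v0; pose s := (Num.sqrt v)^-1.
have s0 : 0 < s by rewrite invr_gt0 sqrtr_gt0.
have sv : s ^+ 2 * v = 1 by rewrite exprVn sqr_sqrtr ?ltW// mulVf// gt_eqF.
have mexp : measurable_fun setT (fun x : measurableTypeR R => expR ((1 - v) / 2 * x ^+ 2)).
  by apply: measurableT_comp => //; apply: measurable_funM => //; exact: measurable_funX.
rewrite gauss_density; [|exact/measurable_EFinP|by move=> x; rewrite lee_fin expR_ge0].
transitivity (s%:E * \int[lebesgue_measure]_x (normal_pdf 0 s x)%:E)%E; last first.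
  by rewrite integral_normal_pdf mule1.
have mpdf : measurable_fun setT (fun x : measurableTypeR R => (normal_pdf 0 s x)%:E).
  by apply/measurable_EFinP; exact: measurable_normal_pdf.
have pdf0 (x : measurableTypeR R) : setT x -> (0 <= (normal_pdf 0 s x)%:E)%E.
  by move=> _; rewrite lee_fin normal_pdf_ge0.
have s0' : (0 <= s%:E)%E by rewrite lee_fin ltW.
rewrite -(ge0_integralZl lebesgue_measure measurableT mpdf pdf0 s0').
apply: eq_integral => x _; rewrite -!EFinM; congr EFin.
rewrite !normal_pdfE ?oner_eq0 ?gt_eqF// /normal_fun /normal_peak.
rewrite mulrCA -expRD [RHS]mulrA; congr (_ * expR _).
  rewrite expr1n mul1r -mulrnAr sqrtrM ?sqr_ge0// sqrtr_sqr gtr0_norm//.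
  by rewrite invfM mulrA divff ?mul1r// gt_eqF.
rewrite !subr0 expr1n -mulr_natr -[s ^+ 2 *+ 2]mulr_natr.
have -> : s ^+ 2 = v^-1 by rewrite exprVn sqr_sqrtr ?ltW.
by field; rewrite gt_eqF.
Qed.

Section chi2_tail.
Context d (T : measurableType d) (R : realType) (P : probability T R).
Local Notation RR := (measurableTypeR R).
Context d' (S : measurableType d') (Z : T -> S) (I : finType)
    (J : {set I}) (X : I -> T -> RR).
Hypothesis GZ : gaussian_given P Z J X.

Let chi2 w := \sum_(a in J) X a w ^+ 2.

Lemma measurable_chi2 : measurable_fun setT (chi2 : T -> RR).
Proof.
have [_ mX _] := GZ; rewrite /chi2.
under eq_fun do rewrite big_mkcond.
apply: measurable_sum => a; case: (boolP (a \in J)) => // aJ.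
by apply: measurable_funX; exact: mX.
Qed.

(* [th] is the optimal Chernoff exponent for the threshold [a ^+ 2]; its sign
   turns the event into an upper or a lower tail. *)
Lemma chi2_chernoff (a th : R) : (0 < #|J|)%N -> 0 < a ->
  th = (1 - #|J|%:R / a ^+ 2) / 2 ->
  (P [set w | (th * a ^+ 2 <= th * chi2 w)%R]
   <= (expR (- ((a - Num.sqrt #|J|%:R) ^+ 2 / 2)))%:E)%E.
Proof.
move=> J0 a0 thE; set N := #|J|; set t := Num.sqrt N%:R.
have t0 : 0 < t by rewrite sqrtr_gt0 ltr0n.
have t2 : t ^+ 2 = N%:R by rewrite sqr_sqrtr.
have v0 : 0 < N%:R / a ^+ 2 :> R by rewrite divr_gt0 ?exprn_gt0 ?ltr0n.
have mchi := measurable_chi2.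
pose h (x : RR) := expR (th * x ^+ 2).
have mh : measurable_fun setT h.
  by apply: measurableT_comp => //; apply: measurable_funM => //; exact: measurable_funX.
have mgf := gaussian_given_integral_prod GZ mh (fun x => expR_ge0 _).
rewrite /h thE gauss_mgf_sqr// -EFin_expe -thE in mgf.
have sv : (Num.sqrt (N%:R / a ^+ 2))^-1 = a / t.
  rewrite -t2 -expr_div_n sqrtr_sqr ger0_norm ?invf_div//.
  by rewrite divr_ge0 ?ltW.
rewrite -/N sv in mgf.
set A := [set w | _].
have mA : measurable A.
  have -> : A = (fun w => th * chi2 w : RR) @^-1` [set` `[th * a ^+ 2, +oo[].
    by apply/seteqP; split => w /=; rewrite in_itv/= andbT.
  rewrite -[X in measurable X]setTI; apply: measurable_funM => //.
have mprod : measurable_fun setT (fun w => \prod_(b in J) h (X b w) : RR).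
  have [_ mX _] := GZ.
  under eq_fun do rewrite big_mkcond.
  apply: measurable_prod => b _; case: (boolP (b \in J)) => // bJ.
  by have := mX b bJ => mXb; exact: (measurableT_comp mh mXb).
(* Markov's inequality for the exponential of [th * chi2]: the indicator of [A] is bounded
   pointwise. *)
apply: (@le_trans _ _ (\int[P]_w ((expR (- (th * a ^+ 2)))%:E * (\prod_(b in J) h (X b w))%:E))%E).
  rewrite -[A]setIT -integral_indic//; apply: ge0_le_integral => //.
  - exact/measurable_EFinP/measurable_indic.
  - by apply: emeasurable_funM => //; exact/measurable_EFinP.
  move=> w _; rewrite -EFinM lee_fin /h -expR_sum -expRD -mulr_sumr.
  rewrite indicE; case: (boolP (w \in A)) => [|_]; last exact: expR_ge0.
  by rewrite inE /A /= => H; rewrite -expR0 ler_expR addrC subr_ge0.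
rewrite ge0_integralZl//; last 2 first.
- exact/measurable_EFinP.
- by move=> w _; rewrite lee_fin prodr_ge0// => b _; exact: expR_ge0.
rewrite mgf -EFinM lee_fin.
(* From [1 + x <= exp x] at [x = a / t - 1] and [N = t^2]. Together with [th a^2 = (a^2 - t^2) / 2]
   it gives the exponent [- (a - t)^2 / 2]. *)
have at1 : (a / t) ^+ N <= expR (t * (a - t)).
  have -> : t * (a - t) = N%:R * (a / t - 1).
    by rewrite -t2; field; rewrite gt_eqF.
  rewrite expRM_natl; apply: lerXn2r; rewrite ?nnegrE ?expR_ge0 ?divr_ge0 ?(ltW a0) ?(ltW t0)//.
  by have := expR_ge1Dx (a / t - 1); rewrite [X in X <= _]addrC subrK.
apply: (le_trans (ler_wpM2l (expR_ge0 _) at1)).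
rewrite -expRD ler_expR le_eqVlt; apply/orP; left; apply/eqP.
by rewrite thE -/N -t2; field; rewrite gt_eqF.
Qed.

Lemma chi2_upper (a D : R) : (0 < #|J|)%N -> 0 <= D ->
  Num.sqrt #|J|%:R + D <= a ->
  (P [set w | (a ^+ 2 < chi2 w)%R] <= (expR (- (D ^+ 2 / 2)))%:E)%E.
Proof.
move=> J0 D0 Da; set t := Num.sqrt _ in Da.
have t0 : 0 < t by rewrite sqrtr_gt0 ltr0n.
have t2 : t ^+ 2 = #|J|%:R by rewrite sqr_sqrtr.
have a0 : 0 < a by rewrite (lt_le_trans t0)// (le_trans _ Da)// lerDl.
apply: (@le_trans _ _ (expR (- ((a - t) ^+ 2 / 2)))%:E); last first.
  rewrite lee_fin ler_expR lerN2 ler_pM2r ?invr_gt0//.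
  by apply: lerXn2r; rewrite ?nnegrE//; lra.
have mchi := measurable_chi2.
have mth (th : R) : measurable [set w | (th * a ^+ 2 <= th * chi2 w)%R].
  rewrite (_ : [set w | _] = (fun w => th * chi2 w : RR) @^-1` [set` `[th * a ^+ 2, +oo[]).
    rewrite -[X in measurable X]setTI; apply: measurable_funM => //.
    by apply/seteqP; split => w /=; rewrite in_itv/= andbT.
apply: le_trans (chi2_chernoff J0 a0 erefl); apply: le_measure; rewrite ?inE//.
  rewrite (_ : [set w | _] = (chi2 : T -> RR) @^-1` [set` `]a ^+ 2, +oo[]).
    by rewrite -[X in measurable X]setTI; apply: mchi => //; exact: measurable_itv.
  by apply/seteqP; split => w /=; rewrite in_itv/= andbT.
(* As [a >= t], the Chernoff exponent is nonnegative and the event is an upper tail. *)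
move=> w /= Hw; apply: ler_wpM2l; last exact: ltW.
rewrite divr_ge0// subr_ge0 -t2 ler_pdivrMr ?exprn_gt0// mul1r.
by apply: lerXn2r; rewrite ?nnegrE; lra.
Qed.

Lemma chi2_lower (z : R) : (0 < #|J|)%N -> 0 < z -> z <= 1 ->
  (P [set w | (chi2 w < z ^+ 2 * #|J|%:R)%R] <=
   (expR (- (#|J|%:R * (1 - z) ^+ 2 / 2)))%:E)%E.
Proof.
move=> J0 z0 z1; pose t := Num.sqrt (#|J|%:R : R).
have t0 : 0 < t by rewrite sqrtr_gt0 ltr0n.
have t2 : t ^+ 2 = #|J|%:R by rewrite sqr_sqrtr.
have a0 : 0 < z * t by rewrite mulr_gt0.
have -> : #|J|%:R * (1 - z) ^+ 2 = (z * t - t) ^+ 2 by rewrite -t2; ring.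
have mchi := measurable_chi2.
have mth (th : R) : measurable [set w | (th * (z * t) ^+ 2 <= th * chi2 w)%R].
  rewrite (_ : [set w | _] = (fun w => th * chi2 w : RR) @^-1` [set` `[th * (z * t) ^+ 2, +oo[]).
    rewrite -[X in measurable X]setTI; apply: measurable_funM => //.
    by apply/seteqP; split => w /=; rewrite in_itv/= andbT.
apply: le_trans (chi2_chernoff J0 a0 erefl); apply: le_measure; rewrite ?inE//.
  rewrite (_ : [set w | _] = (chi2 : T -> RR) @^-1` [set` `]-oo, z ^+ 2 * #|J|%:R[]).
    by rewrite -[X in measurable X]setTI; apply: mchi => //; exact: measurable_itv.
  by apply/seteqP; split => w /=; rewrite in_itv.
(* The threshold [z t] is at most [t], so the exponent is nonpositive and the inequality is
   reversed. *)
move=> w /= Hw; rewrite -t2 exprMn; apply: ler_wnM2l; last by rewrite t2; exact: ltW.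
rewrite pmulr_lle0 ?invr_gt0// subr_le0 ler_pdivlMr ?mulr_gt0 ?exprn_gt0// mul1r.
by rewrite ler_piMl ?sqr_ge0// exprn_ile1// ltW.
Qed.

End chi2_tail.

(** * Operator norm of a Gaussian matrix *)

Section form_bound.
Variable R : realType.

Definition nsq n (u : 'rV[R]_n) : R := \sum_i u 0 i ^+ 2.
Definition head_sqr n (u : 'rV[R]_n) : R := \sum_(i < n | i == 0%N :> nat) u 0 i ^+ 2.

(* By AM-GM and homogeneity, [form_bound s b G] bounds by [s] the operator norm
   of [G] with the extra column [sqrt (s b) e_0]; this column carries the part of
   the bidiagonal form that has already been processed. *)
Definition form_bound r m (s b : R) (G : 'M[R]_(r, m)) : Prop :=
  forall (u : 'rV[R]_r) (v : 'rV[R]_m),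
    2 * (u *m G *m v^T) 0 0 + b * head_sqr u <= s * (nsq u + nsq v).

Lemma nsq_ge0 n (u : 'rV[R]_n) : 0 <= nsq u.
Proof. by apply: sumr_ge0 => i _; exact: sqr_ge0. Qed.

Lemma nsqE n (u : 'rV[R]_n) : nsq u = (u *m u^T) 0 0.
Proof. by rewrite mxE; apply: eq_bigr => i _; rewrite mxE expr2. Qed.

Lemma nsq_orthogonal n (u : 'rV[R]_n) (Q : 'M[R]_n) : Q *m Q^T = 1%:M -> nsq (u *m Q) = nsq u.
Proof. by move=> QQ; rewrite !nsqE trmx_mul mulmxA -(mulmxA u) QQ mulmx1. Qed.

Lemma head_sqr_recl n (u : 'rV[R]_n.+1) : head_sqr u = u 0 ord0 ^+ 2.
Proof.
rewrite /head_sqr (bigD1 ord0)//= big1 ?addr0// => i /andP[/eqP i0].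
by rewrite -val_eqE /= i0.
Qed.

Lemma head_sqr_ge0 n (u : 'rV[R]_n) : 0 <= head_sqr u.
Proof. by apply: sumr_ge0 => i _; exact: sqr_ge0. Qed.

Lemma head_sqr_le n (u : 'rV[R]_n) : head_sqr u <= nsq u.
Proof.
rewrite /nsq (bigID (fun i : 'I_n => i == 0%N :> nat))/= lerDl.
by apply: sumr_ge0 => i _; exact: sqr_ge0.
Qed.

Lemma form_bound_orthogonal r m (s b : R) (G : 'M[R]_(r, m)) (Q : 'M[R]_m) :
  Q *m Q^T = 1%:M -> form_bound s b (G *m Q) -> form_bound s b G.
Proof.
move=> QQ H u v; have := H u (v *m Q).
by rewrite nsq_orthogonal// trmx_mul !mulmxA -(mulmxA (u *m G)) QQ mulmx1.
Qed.

Lemma form_bound_no_row m (s b : R) (G : 'M[R]_(0, m)) : 0 <= s -> form_bound s b G.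
Proof.
move=> s0 u v; rewrite [u]thinmx0 /head_sqr !mul0mx mxE big_ord0 !mulr0 addr0.
by rewrite mulr_ge0 ?addr_ge0 ?nsq_ge0.
Qed.

Lemma form_bound_no_col r (s b : R) (G : 'M[R]_(r, 0)) : 0 <= b -> b <= s -> form_bound s b G.
Proof.
move=> b0 bs u v; rewrite [v]thinmx0 trmx0 mulmx0 mxE mulr0 add0r.
rewrite (le_trans (ler_wpM2l b0 (head_sqr_le u)))//.
by apply: ler_pM; rewrite ?nsq_ge0// lerDl nsq_ge0.
Qed.

(** Let [p], [q] be the leading coordinates of [u], [v] and [x] the corner of [G]; then
    [2 p x q <= a p^2 + a q^2]. The head term of the transposed block pays for [a q^2], and [a p^2]
    added to the head term [b p^2] is exactly the available [(a + b) p^2]. *)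
Lemma form_bound_step r m (a b : R) (G : 'M[R]_(r.+1, m.+1)) :
  (forall j, j != ord0 -> G ord0 j = 0) -> `|G ord0 ord0| <= a ->
  form_bound (b + a) a (row' ord0 G)^T -> form_bound (a + b) b G.
Proof.
move=> G0 Ga H u v.
pose u' := \row_i u 0 (lift ord0 i).
have := H v u'; rewrite !head_sqr_recl.
have -> : nsq u = u 0 ord0 ^+ 2 + nsq u'.
  by rewrite /nsq big_ord_recl; congr (_ + _); apply: eq_bigr => i _; rewrite mxE.
have -> : (v *m (row' ord0 G)^T *m u'^T) 0 0 = (u' *m row' ord0 G *m v^T) 0 0.
  by rewrite -[in RHS](trmxK (u' *m _)) -trmx_mul [RHS]mxE !trmx_mul mulmxA.
have -> : (u *m G *m v^T) 0 0 = u 0 ord0 * G ord0 ord0 * v 0 ord0 + (u' *m row' ord0 G *m v^T) 0 0.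
  rewrite !mxE [in X in _ = _ + X](eq_bigr (fun j => (\sum_i u' 0 i * row' ord0 G i j) * v 0 j)); last first.
    by move=> j _; rewrite !mxE.
  transitivity (\sum_j (u 0 ord0 * G ord0 j * v 0 j + (\sum_i u' 0 i * row' ord0 G i j) * v 0 j)).
    apply: eq_bigr => j _; rewrite !mxE big_ord_recl mulrDl; congr (_ + _ * _).
    by apply: eq_bigr => i _; rewrite !mxE.
  rewrite big_split/=; congr (_ + _).
  rewrite (bigD1 ord0)//= big1 ?addr0// => j j0.
  by rewrite G0// mulr0 mul0r.
move: Ga; rewrite ler_norml => /andP[xa xb].
set x := G _ _ in xa xb *; set p := u 0 _; set q := v 0 _.
set B := (_ *m _ *m _) 0 0.
(* The sum of [h1] and [h2] is [0 <= 2 a (p^2 + q^2) - 4 x p q]. *)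
have h1 : 0 <= (a + x) * (p - q) ^+ 2 by rewrite mulr_ge0 ?sqr_ge0//; lra.
have h2 : 0 <= (a - x) * (p + q) ^+ 2 by rewrite mulr_ge0 ?sqr_ge0//; lra.
move=> H2; have h3 : 2 * (p * x * q) <= a * (p ^+ 2 + q ^+ 2) by nra.
nra.
Qed.
End form_bound.

Section gaussian_form_bound.
Context d (T : measurableType d) (R : realType) (P : probability T R).
Local Notation RR := (measurableTypeR R).

Lemma gaussian_matrix_tr d' (S : measurableType d') (Z : T -> S) p q (G : T -> 'M[R]_(p, q)) :
  gaussian_matrix P Z G -> gaussian_matrix P Z (fun w => (G w)^T).
Proof.
move=> GG; pose f (ij : 'I_q * 'I_p) := (ij.2, ij.1).
have fI : injective f by move=> [a b] [a' b'] [-> ->].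
have := @gaussian_given_reindex _ _ _ _ _ _ Z _ _ f [set: 'I_q * 'I_p]%SET
  (fun ij w => G w ij.1 ij.2) fI.
have -> : f @: [set: 'I_q * 'I_p]%SET = [set: 'I_p * 'I_q]%SET.
  by apply/setP => -[a b]; rewrite finset.in_setT; apply/imsetP; exists (b, a).
move=> /(_ P GG); congr gaussian_given.
by apply/funext => -[a b]; apply/funext => w; rewrite /= mxE.
Qed.

(** Each step peels off one row and transposes the rest, so [r + m] drops by one and [a], [b]
    exchange roles. The statement is uniform in [Z] because the peeled row joins the conditioning
    element. One chi event per step accounts for the factor [r + m]. *)
Lemma gaussian_matrix_form_bound n : forall r m d' (S : measurableType d') (Z : T -> S)
    (G : T -> 'M[R]_(r, m)) (a b D : R),
  (r + m <= n)%N -> gaussian_matrix P Z G -> 0 <= D ->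
  Num.sqrt m%:R + D <= a -> Num.sqrt r%:R + D <= b ->
  exists F : set T, [/\ measurable F,
    (P F <= ((r + m)%:R * expR (- (D ^+ 2 / 2)))%:E)%E &
    forall w, ~ F w -> form_bound (a + b) b (G w)].
Proof.
elim: n => [|n IH] [|r] [|m] d' S Z G a b D // rmn GG D0 Da Db;
  have a0 : 0 <= a by rewrite (le_trans _ Da)// addr_ge0 ?sqrtr_ge0.
(* Without rows or without columns the form bound holds surely, and the bad event is empty. *)
- exists set0; split => //; first by rewrite measure0 lee_fin mul0r.
  by move=> w _; apply: form_bound_no_row; rewrite addr_ge0// (le_trans _ Db)// addr_ge0 ?sqrtr_ge0.
- exists set0; split => //; first by rewrite measure0 lee_fin mul0r.
  by move=> w _; apply: form_bound_no_row; rewrite addr_ge0// (le_trans _ Db)// addr_ge0 ?sqrtr_ge0.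
- exists set0; split => //; first by rewrite measure0 lee_fin mulr_ge0 ?expR_ge0.
  by move=> w _; apply: form_bound_no_row; rewrite addr_ge0// (le_trans _ Db)// addr_ge0 ?sqrtr_ge0.
- exists set0; split => //; first by rewrite measure0 lee_fin mulr_ge0 ?expR_ge0.
  by move=> w _; apply: form_bound_no_col; rewrite ?lerDr// (le_trans _ Db)// addr_ge0 ?sqrtr_ge0.
pose K := [set ij : 'I_r.+1 * 'I_m.+1 | ij.1 == ord0]%SET.
pose f (ij : 'I_r * 'I_m.+1) := (lift ord0 ij.1, ij.2).
have fI : injective f.
  move=> [i j] [i' j'] e; have /= -> := congr1 snd e.
  by have /lift_inj /= -> := congr1 fst e.
pose J := f @: [set: 'I_r * 'I_m.+1]%SET.
have inJ i j : ((i, j) \in J) = (i != ord0).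
  apply/imsetP/idP => [[[i' j'] _ [-> _]]|]; first by rewrite -(inj_eq val_inj).
  by case: (unliftP ord0 i) => [i' -> _|->]; [exists (i', j)|rewrite eqxx].
have KJ : [disjoint K & J]%B.
  apply/pred0P => -[i j]; rewrite /= inJ inE /=.
  by case: (i == ord0).
have KJT : K :|: J = [set: 'I_r.+1 * 'I_m.+1]%SET.
  by apply/setP => -[i j]; rewrite finset.in_setU inJ !inE orbN.
have KcardE : #|K| = m.+1.
  have -> : K = [set (ord0, j) | j : 'I_m.+1]%SET.
    apply/setP => -[i j]; rewrite inE /=; apply/eqP/imsetP => [->|[j' _ [-> _]]//].
    by exists j.
  by rewrite card_imset ?card_ord// => j j' [].
have GKJ : gaussian_given P Z (K :|: J) (fun ij w => G w ij.1 ij.2) by rewrite KJT.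
have GK : gaussian_given P Z K (fun ij w => G w ij.1 ij.2).
  by apply: gaussian_given_subset GKJ; exact: finset.subsetUl.
have [d1 [S1 [Z1 [g [GJ _ _ Xf]]]]] := gaussian_given_absorb_set KJ GKJ.
have /choice [h hP] : forall j : 'I_m.+1, exists h : S1 -> RR,
    measurable_fun setT h /\ (fun w => G w ord0 j) = h \o Z1.
  by move=> j; have := Xf (ord0, j); rewrite inE eqxx => /(_ isT).
pose W z : 'M[R]_(1, m.+1) := \row_j h j z.
have WZ w : W (Z1 w) = row ord0 (G w).
  by apply/rowP => j; rewrite !mxE; have [_ /(congr1 (fun k => k w)) /= ->] := hP j.
have mW i j : measurable_fun setT (fun z => W z i j : RR).
  by under eq_fun do rewrite mxE; exact: (hP j).1.
have GL : gaussian_matrix P Z1 (fun w => row' ord0 (G w)).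
  have := gaussian_given_reindex fI GJ; congr gaussian_given.
  by apply/funext => -[i j]; apply/funext => w; rewrite /= mxE.
(* The rotation is a function of the first row, which [Z1] now contains; the lower rows stay
   standard Gaussian given [Z1]. *)
have [Q [QQ Wlow GQ]] := random_LQ mW GL.
(* The transposed block has [m.+1] rows and [r] columns, so [b] becomes the threshold for columns
   and [a] the one for rows. *)
have [|//||F [mF PF FP]] := IH m.+1 r d1 S1 Z1 _ b a D _ (gaussian_matrix_tr GQ) D0.
- by rewrite addnC.
- by rewrite (le_trans _ Db)// lerD2r ler_sqrt ?ler_nat// ltr0n.
- exact: Da.
pose chi w := \sum_(ij in K) G w ij.1 ij.2 ^+ 2.
pose F2 := [set w | a ^+ 2 < chi w].
have mF2 : measurable F2.
  rewrite (_ : F2 = (chi : T -> RR) @^-1` [set` `]a ^+ 2, +oo[]).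
    by rewrite -[X in measurable X]setTI; apply: (measurable_chi2 GK).
  by apply/seteqP; split => w /=; rewrite in_itv/= andbT.
exists (F `|` F2); split; first exact: measurableU.
  apply: (le_trans (measureU2 _ mF mF2)).
  have := chi2_upper GK _ D0; rewrite KcardE => /(_ a isT Da) PF2.
  apply: (le_trans (leeD PF PF2)).
  have -> : (r.+1 + m.+1)%:R = (m.+1 + r)%:R + 1 :> R by rewrite natr1 addSn addnC.
  by rewrite -EFinD lee_fin mulrDl mul1r.
move=> w /not_orP[Fw F2w].
apply: (form_bound_orthogonal (QQ (Z1 w))); apply: form_bound_step.
- move=> j j0; have := Wlow (Z1 w) ord0 j; rewrite lt0n => /(_ j0).
  by rewrite WZ -row_mul mxE.
- have : (G w *m Q (Z1 w)) ord0 ord0 ^+ 2 <= a ^+ 2.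
    (* The orthogonal [Q] keeps the norm of the first row, all of which now sits in the corner
       entry. *)
    have <- : nsq (W (Z1 w) *m Q (Z1 w)) = (G w *m Q (Z1 w)) ord0 ord0 ^+ 2.
      rewrite /nsq (bigD1 ord0)//= big1 ?addr0; last first.
        by move=> j j0; rewrite (Wlow (Z1 w) ord0 j) ?expr0n// lt0n.
      by rewrite WZ -row_mul mxE.
    rewrite nsq_orthogonal//; move/negP: F2w; rewrite -leNgt; apply: le_trans.
    rewrite /chi /nsq.
    rewrite (eq_bigl (fun ij => (ij.1 == ord0) && true)); last by move=> ij; rewrite inE andbT.
    rewrite -(pair_big (fun i => i == ord0) xpredT (fun i j => G w i j ^+ 2))/= big_pred1_eq.
    by rewrite WZ; apply: ler_sum => j _; rewrite mxE.
  by rewrite -[X in X <= _]real_normK ?num_real// ler_sqr ?nnegrE.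
have := FP w Fw; congr (form_bound _ _ _^T).
by apply/matrixP => i j; rewrite !mxE; apply: eq_bigr => k _; rewrite mxE.
Qed.

End gaussian_form_bound.

(** * The deterministic estimate *)

Section trace_inner_product.
Variable R : realType.

Definition ip n m (A B : 'M[R]_(n, m)) : R := \tr (A^T *m B).

Lemma ipC n m (A B : 'M[R]_(n, m)) : ip A B = ip B A.
Proof. by rewrite /ip -mxtrace_tr trmx_mul trmxK. Qed.

Lemma ipDr n m (A B C : 'M[R]_(n, m)) : ip A (B + C) = ip A B + ip A C.
Proof. by rewrite /ip mulmxDr mxtraceD. Qed.

Lemma ipDl n m (A B C : 'M[R]_(n, m)) : ip (A + B) C = ip A C + ip B C.
Proof. by rewrite ipC ipDr ![ip C _]ipC. Qed.

Lemma ipZr n m a (A B : 'M[R]_(n, m)) : ip A (a *: B) = a * ip A B.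
Proof. by rewrite /ip -scalemxAr mxtraceZ. Qed.

Lemma ipZl n m a (A B : 'M[R]_(n, m)) : ip (a *: A) B = a * ip A B.
Proof. by rewrite ipC ipZr ipC. Qed.

Lemma ipNr n m (A B : 'M[R]_(n, m)) : ip A (- B) = - ip A B.
Proof. by rewrite -scaleN1r ipZr mulN1r. Qed.

Lemma ipNl n m (A B : 'M[R]_(n, m)) : ip (- A) B = - ip A B.
Proof. by rewrite ipC ipNr ipC. Qed.

Lemma ip_mulmxl n m p (C : 'M[R]_(n, p)) (A : 'M[R]_(p, m)) (B : 'M[R]_(n, m)) :
  ip (C *m A) B = ip A (C^T *m B).
Proof. by rewrite /ip trmx_mul mulmxA. Qed.

Lemma ip_mulmxr n m p (C : 'M[R]_(p, m)) (A : 'M[R]_(n, p)) (B : 'M[R]_(n, m)) :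
  ip (A *m C) B = ip A (B *m C^T).
Proof. by rewrite /ip trmx_mul -mulmxA mxtrace_mulC -mulmxA. Qed.

Lemma ipE n m (A B : 'M[R]_(n, m)) : ip A B = \sum_i \sum_j A i j * B i j.
Proof.
rewrite /ip /mxtrace exchange_big; apply: eq_bigr => j _.
by rewrite mxE; apply: eq_bigr => i _; rewrite mxE.
Qed.

Definition fsq n m (A : 'M[R]_(n, m)) : R := ip A A.

Lemma frobenius_normE n m (A : 'M[R]_(n, m)) : frobenius_norm A = Num.sqrt (fsq A).
Proof. by rewrite /frobenius_norm /fsq ipE. Qed.

Lemma fsq_ge0 n m (A : 'M[R]_(n, m)) : 0 <= fsq A.
Proof. by rewrite /fsq ipE; do 2 (apply: sumr_ge0 => ? _); rewrite -expr2 sqr_ge0. Qed.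

Lemma fsq_eq0 n m (A : 'M[R]_(n, m)) : fsq A = 0 -> A = 0.
Proof.
rewrite /fsq ipE => /eqP; rewrite psumr_eq0 => [/allP H|i _]; last first.
  by apply: sumr_ge0 => j _; rewrite -expr2 sqr_ge0.
apply/matrixP => i j; have := H i (mem_index_enum _); rewrite /=.
rewrite psumr_eq0 => [/allP H'|k _]; last by rewrite -expr2 sqr_ge0.
by have := H' j (mem_index_enum _); rewrite /= -expr2 sqrf_eq0 mxE => /eqP.
Qed.

(** For [A] nonzero, expand the nonnegative squared norm of [fsq A *: B - ip A B *: A]. *)
Lemma ip_sqr_le n m (A B : 'M[R]_(n, m)) : ip A B ^+ 2 <= fsq A * fsq B.
Proof.
have [/fsq_eq0 ->|A0] := eqVneq (fsq A) 0.
  by rewrite /fsq /ip trmx0 !mul0mx mxtrace0 expr0n mul0r.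
have Ap : 0 < fsq A by rewrite lt_neqAle eq_sym A0 fsq_ge0.
have := fsq_ge0 (fsq A *: B - ip A B *: A).
rewrite /fsq ipDl !ipDr -!scaleNr !ipZl !ipZr -!/(fsq _) [ip B A]ipC => H.
rewrite -(ler_pM2l Ap) -subr_ge0; apply: le_trans H _.
by rewrite le_eqVlt; apply/orP; left; apply/eqP; ring.
Qed.

Lemma ip_le n m (A B : 'M[R]_(n, m)) : ip A B <= Num.sqrt (fsq A) * Num.sqrt (fsq B).
Proof.
rewrite -sqrtrM ?fsq_ge0// (le_trans (ler_norm _))// -sqrtr_sqr.
by apply: ler_wsqrtr; exact: ip_sqr_le.
Qed.

(* The operator norm of [M] is at most [s], in the form given by AM-GM and
   homogeneity: it avoids square roots and is additive over orthogonal blocks. *)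
Definition op_bound n m (s : R) (M : 'M[R]_(n, m)) : Prop :=
  forall (u : 'rV[R]_n) (v : 'rV[R]_m), 2 * (u *m M *m v^T) 0 0 <= s * (nsq u + nsq v).

Lemma nsq_tr n (u : 'rV[R]_n) : nsq u = fsq u.
Proof. by rewrite nsqE /fsq /ip mxtrace_mulC /mxtrace big_ord1. Qed.

Section projection.
Context n k (X : 'M[R]_(n, k)).
Hypothesis XX : X^T *m X = 1%:M.

Definition coproj : 'M[R]_n := 1%:M - X *m X^T.

Lemma coproj_tr : coproj^T = coproj.
Proof. by rewrite /coproj linearB/= trmx1 trmx_mul trmxK. Qed.

Lemma coproj_mul : coproj *m X = 0.
Proof. by rewrite /coproj mulmxBl mul1mx -mulmxA XX mulmx1 subrr. Qed.

Lemma coproj_idem : coproj *m coproj = coproj.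
Proof. by rewrite {2}/coproj mulmxBr mulmx1 mulmxA coproj_mul mul0mx subr0. Qed.

Lemma fsq_split m (A : 'M[R]_(m, n)) : fsq A = fsq (A *m X) + fsq (A *m coproj).
Proof.
rewrite /fsq !ip_mulmxr -!mulmxA coproj_tr coproj_idem -ipDr -mulmxDr.
by rewrite /coproj addrC subrK mulmx1.
Qed.

Lemma nsq_split (u : 'rV[R]_n) : nsq u = nsq (u *m X) + nsq (u *m coproj).
Proof. by rewrite !nsq_tr; exact: fsq_split. Qed.

End projection.

(** Testing at [s u] and [u M] gives [2 s |u M|^2 <= s (s^2 |u|^2 + |u M|^2)]. *)
Lemma op_bound_row n m s (M : 'M[R]_(n, m)) u : 0 < s -> op_bound s M ->
  nsq (u *m M) <= s ^+ 2 * nsq u.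
Proof.
move=> s0 H; have := H (s *: u) (u *m M).
rewrite -!scalemxAl mxE -nsqE [nsq (s *: u)]nsq_tr /fsq ipZl ipZr -/(fsq u) -nsq_tr => h.
by rewrite -(ler_pM2l s0); lra.
Qed.

Lemma op_bound_tr n m s (M : 'M[R]_(n, m)) : op_bound s M -> op_bound s M^T.
Proof.
move=> H u v; have := H v u; rewrite addrC.
suff -> : (v *m M *m u^T) 0 0 = (u *m M^T *m v^T) 0 0 by [].
by rewrite -[LHS]/((v *m M *m u^T) 0 0) -[v *m M *m u^T]trmxK [LHS]mxE !trmx_mul trmxK mulmxA.
Qed.

(** [M Y] has [k] columns, each the image of a unit vector and thus of squared norm at most [s^2].
    This is how the rank enters the final bound. *)
Lemma op_bound_fsq n m k s (M : 'M[R]_(n, m)) (Y : 'M[R]_(m, k)) :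
  0 < s -> op_bound s M -> Y^T *m Y = 1%:M -> fsq (M *m Y) <= s ^+ 2 * k%:R.
Proof.
move=> s0 /op_bound_tr H YY.
have -> : fsq (M *m Y) = \sum_(i < k) nsq (row i Y^T *m M^T).
  rewrite /fsq /ip /mxtrace; apply: eq_bigr => i _.
  rewrite mxE /nsq; apply: eq_bigr => j _; rewrite [in LHS]mxE -expr2; congr (_ ^+ 2).
  by rewrite !mxE; apply: eq_bigr => l _; rewrite !mxE mulrC.
apply: (@le_trans _ _ (\sum_(i < k) s ^+ 2)); last by rewrite sumr_const card_ord mulr_natr.
apply: ler_sum => i _; apply: le_trans (op_bound_row _ s0 H) _.
suff -> : nsq (row i Y^T) = 1 by rewrite mulr1.
have /matrixP/(_ i i) := YY; rewrite [RHS]mxE eqxx mulr1n mxE => <-.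
by apply: eq_bigr => j _; rewrite !mxE expr2.
Qed.

Lemma op_bound_coproj n m k s (X : 'M[R]_(n, k)) (M : 'M[R]_(n, m)) :
  0 <= s -> X^T *m X = 1%:M -> op_bound s M -> op_bound s (coproj X *m M).
Proof.
move=> s0 XX H u v; have := H (u *m coproj X) v; rewrite !mulmxA => /le_trans; apply.
apply: ler_wpM2l => //; rewrite lerD2r [leRHS](nsq_split XX).
by rewrite lerDr nsq_ge0.
Qed.

(** The two summands act between orthogonal subspaces, and AM-GM applies on each block separately.
    Such matrices serve as dual certificates for the nuclear norm. *)
Lemma op_bound_svd n m k k' (X : 'M[R]_(n, k)) (Y : 'M[R]_(m, k))
    (X' : 'M[R]_(n, k')) (Y' : 'M[R]_(m, k')) :
  X^T *m X = 1%:M -> Y^T *m Y = 1%:M -> X'^T *m X' = 1%:M -> Y'^T *m Y' = 1%:M ->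
  op_bound 1 (X *m Y^T + coproj X *m (X' *m Y'^T) *m coproj Y).
Proof.
have AMGM l (a b : 'rV[R]_l) : 2 * (a *m b^T) 0 0 <= nsq a + nsq b.
  rewrite mxE mulr_sumr /nsq -big_split/=; apply: ler_sum => i _.
  by rewrite mxE; have := sqr_ge0 (a 0 i - b 0 i); lra.
move=> XX YY XX' YY' u v.
rewrite mul1r mulmxDr mulmxDl mxE (nsq_split XX u) (nsq_split YY v).
have h1 := AMGM _ (u *m X) (v *m Y).
have h2 := AMGM _ (u *m coproj X *m X') (v *m coproj Y *m Y').
have h3 : nsq (u *m coproj X *m X') <= nsq (u *m coproj X).
  by rewrite [leRHS](nsq_split XX') lerDl nsq_ge0.
have h4 : nsq (v *m coproj Y *m Y') <= nsq (v *m coproj Y).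
  by rewrite [leRHS](nsq_split YY') lerDl nsq_ge0.
move: h1 h2; rewrite !trmx_mul coproj_tr !mulmxA; lra.
Qed.

(** Half of the duality between operator and nuclear norms: along an SVD of [A], the bound is
    applied to each pair of singular vectors. *)
Lemma op_bound_nuclear n m s (M A : 'M[R]_(n, m)) :
  op_bound s M -> ip M A <= s * nuclear_norm A.
Proof.
move=> H; have [k [X [Y [sv [_ [XX YY] sv0 AE ->]]]]] := compact_svd A; rewrite AE.
have -> : ip M (X *m diag_mx sv *m Y^T) = \sum_i sv 0 i * ((col i X)^T *m M *m col i Y) 0 0.
  rewrite ipC ip_mulmxr trmxK ip_mulmxl /ip tr_diag_mx /mxtrace.
  apply: eq_bigr => i _; rewrite mul_diag_mx mxE; congr (_ * _).
  rewrite -mulmxA !mxE; apply: eq_bigr => a _; rewrite !mxE; congr (_ * _).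
  by apply: eq_bigr => b _; rewrite !mxE.
rewrite mulr_sumr; apply: ler_sum => i _; rewrite [s * _]mulrC; apply: ler_wpM2l => //.
have unit_col p l (Z : 'M[R]_(p, l)) a : Z^T *m Z = 1%:M -> nsq (col a Z)^T = 1.
  move=> ZZ; have /matrixP/(_ a a) := ZZ; rewrite [RHS]mxE eqxx mulr1n mxE => <-.
  by apply: eq_bigr => j _; rewrite !mxE expr2.
have := H (col i X)^T (col i Y)^T; rewrite !unit_col// trmxK; lra.
Qed.

(** The product [X Y^T] of the singular vector matrices attains equality in the duality, and the
    complementary projections annihilate [A] from either side. *)
Lemma nuclear_norm_dual n m (A : 'M[R]_(n, m)) :
  exists k (X : 'M[R]_(n, k)) (Y : 'M[R]_(m, k)),
  [/\ (k <= \rank A)%N, X^T *m X = 1%:M /\ Y^T *m Y = 1%:M, ip (X *m Y^T) A = nuclear_norm A,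
      coproj X *m A = 0 & A *m coproj Y = 0].
Proof.
have [k [X [Y [sv [kA [XX YY] sv0 AE nE]]]]] := compact_svd A.
exists k, X, Y; split => //.
- rewrite nE AE ip_mulmxl -!mulmxA [X^T *m _]mulmxA XX mul1mx.
  rewrite /ip trmxK mxtrace_mulC -mulmxA YY mulmx1 mxtrace_diag.
  by apply: eq_bigr => i _.
- by rewrite AE !mulmxA coproj_mul// !mul0mx.
- by rewrite AE -mulmxA -[Y^T *m _]trmxK trmx_mul trmxK coproj_tr coproj_mul// trmx0 mulmx0.
Qed.

End trace_inner_product.

(** * Comparison of the penalized objective at two points *)

Section penalized_estimator.
Variable R : realType.

(** Scalar core of [estimator_bound], where [d = |D|^2], [e = |E|], [f = |E - D|], [p = <M, D>], and
    [t], [nu] are the pairing of [D] with [W0] and the nuclear norm of its doubly projected part.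
    Squaring the bound on [f] controls [d] by [p] and [t + nu]; the sign of [t + nu] decides how
    these are absorbed. *)
Lemma basic_inequality (d q e lam t nu p f k eta : R) :
  0 <= q -> q ^+ 2 = k * d -> 0 <= d -> 0 <= nu -> - q <= t -> t <= q -> 0 < e -> 0 < lam ->
  0 <= eta -> eta < 1 -> p <= eta * (lam * e) * (2 * q + nu) ->
  0 <= f -> f <= e - lam * (t + nu) -> f ^+ 2 = e ^+ 2 - 2 * p + d ->
  e ^+ 2 - p <= e * f -> lam ^+ 2 * k <= 2^-1 ->
  d <= (12 + 3 / (1 - eta)) * (lam * e * q).
Proof.
move=> q0 qd d0 nu0 tq1 tq2 e0 lam0 eta0 eta1 pb f0 fb fE cs lk.
have eta1' : 0 < 1 - eta by rewrite subr_gt0.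
pose L := lam * e; have L0 : 0 < L by rewrite mulr_gt0.
have Lq0 : 0 <= L * q by rewrite mulr_ge0// ltW.
have K0 : 0 <= 3 / (1 - eta) * (L * q) by rewrite mulr_ge0// divr_ge0// ltW.
rewrite -/L in pb *; rewrite mulrDl.
have fb2 : f ^+ 2 <= (e - lam * (t + nu)) ^+ 2 by apply: lerXn2r; rewrite ?nnegrE//; lra.
have Lnu0 : 0 <= L * nu by rewrite mulr_ge0// ltW.
have eLq : eta * L * q <= L * q by rewrite -mulrA; apply: ler_piMl => //; exact: ltW.
have eLnu : eta * L * nu <= L * nu by rewrite -mulrA; apply: ler_piMl => //; exact: ltW.
(* If [t + nu <= 0], then [|t + nu| <= q], and the quadratic term is at most [d / 2] by
   [lam^2 k <= 1/2]; doubling the rest gives [12 L q]. *)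
have [g0|g0] := leP (t + nu) 0.
  have h1 : (lam * (t + nu)) ^+ 2 <= 2^-1 * d.
    apply: (@le_trans _ _ (lam ^+ 2 * q ^+ 2)).
      rewrite exprMn ler_wpM2l ?sqr_ge0// -[X in X <= _]sqrrN; apply: lerXn2r; rewrite ?nnegrE; lra.
    by rewrite qd mulrA ler_wpM2r.
  have h2 : - (L * (t + nu)) <= L * q - L * nu.
    by rewrite -mulrBr -mulrN ler_pM2l//; lra.
  have : d <= - 2 * (L * (t + nu)) + (lam * (t + nu)) ^+ 2 + 2 * p.
    by move: fb2; rewrite fE /L; lra.
  have : p <= 2 * (eta * L * q) + eta * L * nu by move: pb; lra.
  lra.
set G := t + nu in g0 fb fb2 *.
(* This comes from the hypothesis [cs], an instance of Cauchy-Schwarz. With [nu <= G + q] it leads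
   to [L G <= eta L (3 q + G)], and [eta < 1] allows solving for [L G]. *)
have LG : L * G <= p.
  have : e * f <= e * (e - lam * G) by rewrite ler_pM2l.
  by move: cs; rewrite /L; lra.
have h1 : (lam * G) ^+ 2 <= L * G.
  have : lam * G <= e by lra.
  have lG : 0 <= lam * G by rewrite mulr_ge0// ltW.
  by move=> /(ler_wpM2l lG); rewrite -expr2 /L; lra.
have nuG : eta * L * nu <= eta * L * G + eta * L * q.
  by rewrite -mulrDr; apply: ler_wpM2l; [rewrite mulr_ge0// ltW|rewrite /G; lra].
have LG2 : L * G <= 3 / (1 - eta) * (L * q).
  rewrite [leRHS]mulrAC ler_pdivlMr//.
  by move: pb LG; lra.
have : d <= - 2 * (L * G) + (lam * G) ^+ 2 + 2 * p.
  by move: fb2; rewrite fE /L; lra.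
have eLG : eta * L * G <= L * G.
  by rewrite -mulrA; apply: ler_piMl; [rewrite mulr_ge0// ltW|exact: ltW].
lra.
Qed.

(** [M] replaces the noise [E] in pairings with [D] only: the error [D] sees just the projected
    noise, while the full norm of [E] sets the scale of the penalty. *)
Lemma estimator_bound n m (M0 D E M : 'M[R]_(n, m)) (s lam eta : R) :
  0 < s -> 0 < lam -> 0 <= eta -> eta < 1 -> 0 < Num.sqrt (fsq E) ->
  s <= eta * (lam * Num.sqrt (fsq E)) -> op_bound s M -> ip E D = ip M D ->
  lam ^+ 2 * (\rank M0)%:R <= 2^-1 ->
  frobenius_norm (E - D) + lam * nuclear_norm (M0 + D) <=
    frobenius_norm E + lam * nuclear_norm M0 ->
  fsq D <= ((12 + 3 / (1 - eta)) * (lam * Num.sqrt (fsq E))) ^+ 2 * (\rank M0)%:R.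
Proof.
move=> s0 lam0 eta0 eta1 e0 sle MB EM lk ineq.
have [k [X [Y [kr [XX YY] W0E XM MY]]]] := nuclear_norm_dual M0.
pose W0 := X *m Y^T.
pose D2 := coproj X *m D *m coproj Y.
have [k' [X' [Y' [_ [XX' YY'] W'E _ _]]]] := nuclear_norm_dual D2.
pose W' := X' *m Y'^T.
pose W := W0 + coproj X *m W' *m coproj Y.
have WB : op_bound 1 W by exact: op_bound_svd.
pose d := fsq D; pose e := Num.sqrt (fsq E).
pose q := Num.sqrt (k%:R * d).
have d0 : 0 <= d by exact: fsq_ge0.
have kd0 : 0 <= k%:R * d by rewrite mulr_ge0.
have q2 : q ^+ 2 = k%:R * d by rewrite sqr_sqrtr.
have qE : q = Num.sqrt k%:R * Num.sqrt d by rewrite /q sqrtrM.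
have fsqW0 : fsq W0 = k%:R.
  rewrite /fsq ip_mulmxl mulmxA XX mul1mx /ip trmxK mxtrace_mulC YY mxtrace1.
  by [].
have tq : ip W0 D <= q by rewrite qE -fsqW0; exact: ip_le.
have tq' : - q <= ip W0 D.
  rewrite lerNl -ipNr qE -fsqW0 (le_trans (ip_le _ _))//.
  by rewrite /d /fsq ipNl ipNr opprK.
have W2M : ip (coproj X *m W' *m coproj Y) M0 = 0.
  by rewrite ip_mulmxr coproj_tr MY /ip mulmx0 mxtrace0.
have W2D : ip (coproj X *m W' *m coproj Y) D = nuclear_norm D2.
  by rewrite ip_mulmxr ip_mulmxl !coproj_tr mulmxA W'E.
have nu0 : 0 <= nuclear_norm D2.
  have [? [? [? [sv [_ _ sv0 _ ->]]]]] := compact_svd D2.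
  by apply: sumr_ge0 => i _; exact: sv0.
(* The certificate [W] pairs with [M0] to its nuclear norm, and with [D] to [ip W0 D] plus the
   nuclear norm of [D2]. *)
have key : nuclear_norm M0 + ip W0 D + nuclear_norm D2 <= nuclear_norm (M0 + D).
  have := op_bound_nuclear (M0 + D) WB; rewrite mul1r => /(le_trans _); apply.
  by rewrite ipDr !ipDl W2M W2D W0E addr0 addrA.
have MD : ip M D <= s * (2 * q + nuclear_norm D2).
  (* Two parts of rank at most [k], each paired with [M] at cost [s q], and the remainder [D2], paid
     for in nuclear norm. *)
  have -> : D = X *m (X^T *m D) + (coproj X *m D *m Y *m Y^T + D2).
    rewrite /D2 -(mulmxA _ Y) -mulmxDr [Y *m Y^T + _]addrC subrK mulmx1.
    by rewrite mulmxA -mulmxDl addrC subrK mul1mx.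
  rewrite !ipDr mulrDr addrA; apply: lerD; last exact: op_bound_nuclear.
  have s2k (x : R) : x <= s ^+ 2 * k%:R -> Num.sqrt x * Num.sqrt d <= s * q.
    move=> xs; rewrite qE mulrA ler_wpM2r ?sqrtr_ge0//.
    rewrite -[X in _ <= X * _](gtr0_norm s0) -sqrtr_sqr -sqrtrM ?sqr_ge0//.
    exact: ler_wsqrtr.
  rewrite mulr2n mulrDl mulrDr mul1r; apply: lerD.
    rewrite ipC ip_mulmxl ipC.
    have -> : ip (X^T *m M) (X^T *m D) = ip (X *m (X^T *m M)) D by rewrite [RHS]ip_mulmxl.
    apply: le_trans (ip_le _ _) _; apply: s2k.
    rewrite /fsq ip_mulmxl mulmxA XX mul1mx.
    have := op_bound_fsq s0 (op_bound_tr MB) XX.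
    by rewrite /fsq /ip !trmx_mul !trmxK mxtrace_mulC -!mulmxA.
  have -> : ip M (coproj X *m D *m Y *m Y^T) = ip (coproj X *m M *m Y *m Y^T) D.
    by rewrite ipC ip_mulmxr trmxK ip_mulmxr ip_mulmxl coproj_tr ipC !mulmxA.
  apply: le_trans (ip_le _ _) _; apply: s2k.
  rewrite /fsq ip_mulmxr trmxK -(mulmxA _ Y^T Y) YY mulmx1.
  by apply: op_bound_fsq => //; apply: op_bound_coproj => //; exact: ltW.
have fE : frobenius_norm (E - D) ^+ 2 = e ^+ 2 - 2 * ip M D + d.
  rewrite frobenius_normE !sqr_sqrtr ?fsq_ge0//.
  rewrite /fsq ipDl !ipDr !ipNr !ipNl [ip D E]ipC EM /d /fsq; ring.
have fD : d <= (12 + 3 / (1 - eta)) * (lam * e * q).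
  apply: (@basic_inequality d q e lam (ip W0 D) (nuclear_norm D2) (ip M D)
    (frobenius_norm (E - D)) k%:R eta) => //.
  - exact: sqrtr_ge0.
  - apply: le_trans MD _; apply: ler_wpM2r => //.
    by rewrite addr_ge0// mulr_ge0// sqrtr_ge0.
  - exact: sqrtr_ge0.
  - move: ineq (ler_wpM2l (ltW lam0) key); rewrite [frobenius_norm E]frobenius_normE -/e.
    move: (nuclear_norm (M0 + D)) (nuclear_norm M0) (nuclear_norm D2) (ip W0 D).
    by move: (frobenius_norm _) => f N1 N2 N3 N4; lra.
  - rewrite -EM frobenius_normE -/e.
    have := ip_le E (E - D); rewrite ipDr ipNr -/(fsq E) -/e.
    by rewrite -[fsq E](sqr_sqrtr (fsq_ge0 E)) -/e.
  - by apply: le_trans lk; rewrite ler_wpM2l ?sqr_ge0// ler_nat.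
have K0 : 0 <= (12 + 3 / (1 - eta)) * (lam * e).
  by rewrite mulr_ge0 ?mulr_ge0 ?addr_ge0 ?divr_ge0 ?subr_ge0 ?ltW.
(* Since [q^2 = k d], squaring [fD] and dividing by [d] gives the claim, so [d = 0] is set apart. *)
have [d00|dn] := eqVneq d 0; first by rewrite -/d d00 mulr_ge0 ?sqr_ge0.
have dp : 0 < d by rewrite lt_neqAle eq_sym dn.
apply: (@le_trans _ _ (((12 + 3 / (1 - eta)) * (lam * e)) ^+ 2 * k%:R)); last first.
  by rewrite ler_wpM2l ?sqr_ge0// ler_nat.
rewrite -(ler_pM2r dp) -mulrA -q2 -exprMn -expr2 -/e.
apply: lerXn2r; rewrite ?nnegrE//; first by apply: mulr_ge0 => //; exact: sqrtr_ge0.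
by move: fD; rewrite !mulrA.
Qed.
End penalized_estimator.

(** * The probabilistic estimate *)

(** Conditioning starts from the constant [tt], which carries no information: an event about it is
    full or empty. *)
Lemma iid_gaussian_matrix d (T : measurableType d) (R : realType) (P : probability T R)
    n m (xi : 'I_n -> 'I_m -> {RV P >-> R}) :
  (forall i j, standard_normal (xi i j)) ->
  mutually_independent (fun ij : 'I_n * 'I_m => xi ij.1 ij.2) ->
  gaussian_matrix P (fun _ : T => tt) (fun w => \matrix_(i, j) xi i j w).
Proof.
move=> hn hi; split => [|ij _|D B mD mB].
- exact: measurable_cst.
- under eq_fun do rewrite mxE. exact: (measurable_funPT (xi ij.1 ij.2)).
under eq_bigr => ij _ do rewrite -[gauss _]/(normal_prob 0 1 (B ij)) -(hn ij.1 ij.2 (B ij) (mB ij)).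
have := hi [set: 'I_n * 'I_m]%SET B mB; rewrite /distribution /pushforward => <-.
have [Dt|Dt] := pselect (D tt).
  rewrite (_ : _ @^-1` D = setT) ?probability_setT ?mul1e; last by apply/seteqP; split.
  congr (P _); apply/seteqP; split => w /=.
    by move=> [_ h] ij /h; rewrite mxE.
  by move=> h; split => // ij /h; rewrite mxE.
rewrite (_ : _ @^-1` D = set0) ?measure0 ?mul0e; last by apply/seteqP; split.
by rewrite (_ : [set w | _] = set0) ?measure0//; apply/seteqP; split => w // [].
Qed.

Section column_space.
Context d (T : measurableType d) (R : realType) (P : probability T R).

(** The rows of [B] form an orthonormal basis of the column space of [V]. [random_LQ], applied to
    the constant matrix [(col_base V)^T], makes [Q^T V] vanish below its first [r] rows, so the
    first [r] rows of [Q^T] serve. *)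
Lemma column_space_compression d' (S : measurableType d') (Z : T -> S)
    n m q (V : 'M[R]_(n, q)) (Xi : T -> 'M[R]_(n, m)) :
  gaussian_matrix P Z Xi ->
  exists B : S -> 'M[R]_(\rank V, n), [/\ forall z, B z *m (B z)^T = 1%:M,
    forall z, (B z)^T *m B z *m V = V & gaussian_matrix P Z (fun w => B (Z w) *m Xi w)].
Proof.
move=> GX; set r := \rank V; pose W (z : S) : 'M[R]_(r, n) := (col_base V)^T.
have mW i j : measurable_fun setT (fun z => W z i j : measurableTypeR R) by exact: measurable_cst.
have [Q [QQ Wlow GQ]] := random_LQ mW (gaussian_matrix_tr GX).
have rn : (r <= n)%N by exact: rank_leq_row.
pose Pr : 'M[R]_(r, n) := rowsub (widen_ord rn) 1%:M.
have PrE p (A : 'M[R]_(n, p)) : Pr *m A = rowsub (widen_ord rn) A.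
  by rewrite mul_rowsub_mx mul1mx.
have PP : Pr *m Pr^T = 1%:M.
  by rewrite PrE; apply/matrixP => i j; rewrite !mxE eq_sym.
exists (fun z => Pr *m (Q z)^T); split => [z|z|].
- by rewrite trmx_mul trmxK mulmxA -(mulmxA Pr) mulmx1C ?QQ// mulmx1.
- rewrite trmx_mul trmxK -!mulmxA.
  suff -> : Pr^T *m (Pr *m ((Q z)^T *m V)) = (Q z)^T *m V by rewrite mulmxA QQ mul1mx.
  have -> : (Q z)^T *m V = (W z *m Q z)^T *m row_base V.
    by rewrite trmx_mul trmxK -mulmxA mulmx_base.
  suff PPA : Pr^T *m (Pr *m (W z *m Q z)^T) = (W z *m Q z)^T.
    by rewrite (mulmxA Pr) (mulmxA Pr^T) PPA.
  apply/matrixP => i j; rewrite PrE mxE [RHS]mxE.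
  have [ir|ir] := ltnP i r.
    rewrite (bigD1 (Ordinal ir))//= big1 ?addr0.
      have wi : widen_ord rn (Ordinal ir) = i by exact/val_inj.
      by rewrite !mxE wi eqxx mul1r.
    move=> k ki; rewrite !mxE (_ : (widen_ord rn k == i) = false) ?mul0r//.
    by apply: contraNF ki; rewrite -!val_eqE.
  (* A row [i >= r] of the transpose consists of entries above the diagonal of the triangular
     factor. *)
  rewrite Wlow ?(leq_trans _ ir)// big1// => k _.
  rewrite !mxE (_ : (widen_ord rn k == i) = false) ?mul0r//.
  by apply/negP => /eqP ki; move: ir; rewrite -ki leqNgt /= ltn_ord.
pose f (ij : 'I_r * 'I_m) := (widen_ord rn ij.1, ij.2).
have fI : injective f.
  move=> [i j] [i' j'] e; have /= -> := congr1 snd e.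
  have /= e1 := congr1 (fun u => val u.1) e.
  by congr (_, _); exact/val_inj.
have GJ := gaussian_given_subset (finset.subsetT (f @: [set: 'I_r * 'I_m]%SET)) (gaussian_matrix_tr GQ).
have := gaussian_given_reindex fI GJ.
rewrite /gaussian_matrix; congr gaussian_given.
apply/funext => -[i j]; apply/funext => w /=.
by rewrite -mulmxA PrE [RHS]mxE -[in RHS](trmxK (Xi w)) -trmx_mul.
Qed.
End column_space.

(* A prefactor is traded for a smaller rate because only the minimum with [1] matters. *)
Lemma rate_absorb (R : realType) (c0 : R) : 0 < c0 -> exists c : R, 0 < c /\
  forall x y : R, 1 <= x -> y <= (x + 2) * expR (- (c0 * x)) ->
    2 * expR (- (c * x)) < 1 -> y <= 2 * expR (- (c * x)).
Proof.
(* [K] is fitted to [x + 2 <= 3 x = K (c0 / 2) x <= K exp (c0 x / 2)]: half of the rate pays for the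
   prefactor. *)
move=> c00; pose K := 6 / c0.
have K0 : 0 < K by rewrite divr_gt0.
have [p Kp] : exists p : nat, K <= 2 ^+ p.+1.
  exists (Num.truncn K).
  apply: le_trans (ltW (truncnS_gt K)) _.
  by rewrite -natrX ler_nat ltnW// ltn_expl.
(* With this rate, [t^(p+1) = 2^(p+1) exp (- c0 x / 2)] dominates [y], and [t^(p+1) <= t] because
   [t < 1]. *)
pose c := c0 / 2 / p.+1%:R.
have c_gt0 : 0 < c by rewrite !divr_gt0.
exists c; split => // x y x1 yx; set t := 2 * _ => t1.
have x0 : 0 < x by exact: lt_le_trans x1.
have t0 : 0 <= t by rewrite mulr_ge0 ?expR_ge0.
apply: (@le_trans _ _ (t ^+ p.+1)); last by rewrite exprS ler_piMr// exprn_ile1// ltW.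
have -> : t ^+ p.+1 = 2 ^+ p.+1 * expR (- (c0 / 2 * x)).
  rewrite exprMn -expRM_natl; congr (_ * expR _).
  have : p.+1%:R != 0 :> R by rewrite pnatr_eq0.
  by rewrite /c; move: p.+1%:R => N N0; field.
apply: le_trans yx _; apply: (@le_trans _ _ (K * expR (- (c0 / 2 * x)))); last first.
  by rewrite ler_wpM2r ?expR_ge0.
have -> : - (c0 * x) = - (c0 / 2 * x) - (c0 / 2 * x) by field.
rewrite expRD mulrA ler_wpM2r ?expR_ge0//.
rewrite expRN ler_pdivrMr ?expR_gt0//.
apply: (@le_trans _ _ (K * (c0 / 2 * x))); last first.
  rewrite ler_wpM2l ?ltW//; have := expR_ge1Dx (c0 / 2 * x); lra.
rewrite /K (_ : 6 / c0 * _ = 3 * x); first lra.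
by field; rewrite gt_eqF.
Qed.

Lemma op_bound_isometry (R : realType) r n m (a sigma : R) (B : 'M[R]_(r, n)) (G : 'M[R]_(r, m)) :
  0 <= a -> 0 <= sigma -> B *m B^T = 1%:M -> op_bound a G ->
  op_bound (sigma * a) (sigma *: (B^T *m G)).
Proof.
move=> a0 s0 BB H u v.
have := ler_wpM2l s0 (H (u *m B^T) v).
have -> : (u *m (sigma *: (B^T *m G)) *m v^T) 0 0 = sigma * (u *m B^T *m G *m v^T) 0 0.
  by rewrite -scalemxAr -scalemxAl mxE !mulmxA.
move=> h; rewrite mulrCA (le_trans h)// -[leRHS]mulrA.
rewrite ler_wpM2l// ler_wpM2l// lerD2r [leRHS](@nsq_split _ _ _ B^T) ?trmxK//.
by rewrite lerDl nsq_ge0.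
Qed.

Lemma form_bound_op_bound (R : realType) r m (s b : R) (G : 'M[R]_(r, m)) :
  0 <= b -> form_bound s b G -> op_bound s G.
Proof.
move=> b0 H u v; apply: le_trans (H u v).
by rewrite lerDl mulr_ge0// head_sqr_ge0.
Qed.

(** Three bad events: a large operator norm of the projected noise, and a noise norm too small or
    too large. The lower bound on the norm makes the penalty dominate; the upper one bounds the
    final error. [M] is the projection of [Xi] to the column space of [V], so pairings with [V H]
    are unchanged. *)
Lemma gaussian_design_events d (T : measurableType d) (R : realType) (P : probability T R)
    n m q (V : 'M[R]_(n, q)) (Xi : T -> 'M[R]_(n, m)) (alpha beta : R) :
  (0 < n)%N -> (0 < m)%N -> 0 < alpha -> alpha < 1 -> 0 < beta ->
  gaussian_matrix P (fun _ : T => tt) Xi ->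
  let r := \rank V in
  let t := Num.sqrt m%:R + Num.sqrt r%:R in
  exists F : set T, [/\ measurable F,
    (P F <= ((r + m)%:R * expR (- ((beta / 2 * t) ^+ 2 / 2)) +
      expR (- ((n * m)%:R * (alpha / 2) ^+ 2 / 2)) + expR (- ((n * m)%:R / 2)))%:E)%E &
    forall w, ~ F w ->
      [/\ (1 - alpha / 2) ^+ 2 * (n * m)%:R <= fsq (Xi w), fsq (Xi w) <= 4 * (n * m)%:R &
      exists M : 'M[R]_(n, m), op_bound ((1 + beta) * t) M /\
        forall H, ip (Xi w) (V *m H) = ip M (V *m H)]].
Proof.
move=> n0 m0 al0 al1 be0 GX r t.
have [B [BB BV GB]] := column_space_compression V GX.
have t0 : 0 <= t by rewrite addr_ge0 ?sqrtr_ge0.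
(* Half of the slack [beta t] goes to each threshold: [sqrt m + D + sqrt r + D = (1 + beta) t]. *)
pose D := beta / 2 * t.
have D0 : 0 <= D by rewrite mulr_ge0// divr_ge0// ltW.
have [F1 [mF1 PF1 F1P]] := gaussian_matrix_form_bound (leqnn _) GB D0 (lexx _) (lexx _).
pose N := (n * m)%N.
have Ncard : #|[set: 'I_n * 'I_m]%SET| = N by rewrite cardsT card_prod !card_ord.
have N0 : (0 < #|[set: 'I_n * 'I_m]%SET|)%N by rewrite Ncard muln_gt0 n0.
pose chi w := \sum_(ij in [set: 'I_n * 'I_m]%SET) Xi w ij.1 ij.2 ^+ 2.
have chiE w : chi w = fsq (Xi w).
  rewrite /fsq ipE (pair_big xpredT xpredT (fun i j => Xi w i j * Xi w i j))/=.
  by apply: eq_big => [ij|ij _]; [rewrite finset.in_setT|rewrite expr2].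
have z0 : 0 < 1 - alpha / 2 by lra.
have z1 : 1 - alpha / 2 <= 1 by lra.
have PF2 := chi2_lower GX N0 z0 z1.
have PF3 := @chi2_upper _ _ _ _ _ _ _ _ _ _ GX (2 * Num.sqrt N%:R) (Num.sqrt N%:R) N0 (sqrtr_ge0 _).
rewrite Ncard in PF2 PF3.
have {}PF3 := PF3 (_ : Num.sqrt N%:R + Num.sqrt N%:R <= 2 * Num.sqrt N%:R).
set F2 := [set w | _] in PF2; set F3 := [set w | _] in PF3.
have mchi := measurable_chi2 GX.
have mF2 : measurable F2.
  rewrite (_ : F2 = (chi : T -> measurableTypeR R) @^-1` [set` `]-oo, (1 - alpha / 2) ^+ 2 * N%:R[]).
    by rewrite -[X in measurable X]setTI; apply: mchi.
  by apply/seteqP; split => w /=; rewrite in_itv.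
have mF3 : measurable F3.
  rewrite (_ : F3 = (chi : T -> measurableTypeR R) @^-1` [set` `](2 * Num.sqrt N%:R) ^+ 2, +oo[]).
    by rewrite -[X in measurable X]setTI; apply: mchi.
  by apply/seteqP; split => w /=; rewrite in_itv/= andbT.
exists (F1 `|` F2 `|` F3); split.
- by apply: measurableU => //; exact: measurableU.
- apply: (le_trans (measureU2 _ _ _)) => //; first exact: measurableU.
  rewrite EFinD; apply: leeD.
    apply: (le_trans (measureU2 _ _ _)) => //.
    rewrite EFinD; apply: leeD => //.
    apply: le_trans PF2 _; rewrite lee_fin (_ : 1 - (1 - alpha / 2) = alpha / 2)//; lra.
  apply: le_trans (PF3 _) _; first by rewrite mulr_natl mulr2n.
  by rewrite sqr_sqrtr.
move=> w /not_orP[/not_orP[F1w F2w] F3w].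
have F2w' : (1 - alpha / 2) ^+ 2 * N%:R <= chi w by rewrite leNgt; exact/negP.
have F3w' : chi w <= (2 * Num.sqrt N%:R) ^+ 2 by rewrite leNgt; exact/negP.
split; first by rewrite -chiE.
  by rewrite -chiE (le_trans F3w')// exprMn sqr_sqrtr// (_ : 2 ^+ 2 = 4)//; ring.
exists ((B tt)^T *m (B tt *m Xi w)); split; last first.
  by move=> H; rewrite mulmxA ip_mulmxl trmx_mul trmxK [in RHS]mulmxA BV.
have b0 : 0 <= Num.sqrt r%:R + D by rewrite addr_ge0 ?sqrtr_ge0.
have := form_bound_op_bound b0 (F1P w F1w).
have -> : Num.sqrt m%:R + D + (Num.sqrt r%:R + D) = (1 + beta) * t.
  by rewrite /D /t; field.
move=> /(op_bound_isometry _ ler01 (BB tt)); rewrite mul1r scale1r; apply.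
by rewrite mulr_ge0//; lra.
Qed.

Theorem theorem4 (R : realType) (alpha beta rho : R)
    (halpha0 : 0 < alpha) (halpha1 : alpha < 1) (hbeta : 0 < beta)
    (hrho0 : 0 < rho) (hrho1 : rho < 1) :
  exists c C : R, 0 < c /\ 0 < C /\
  forall (n m1 m2 : nat) (hn : (0 < n)%N) (hm1 : (0 < m1)%N) (hm2 : (0 < m2)%N)
    (V : 'M[R]_(n, m1)) (A0 : 'M[R]_(m1, m2)) (sigma : R) (hsigma : 0 < sigma)
    (d : measure_display) (T : measurableType d) (P : probability T R)
    (xi : 'I_n -> 'I_m2 -> {RV P >-> R})
    (hnormal : forall i j, standard_normal (xi i j))
    (hindep : mutually_independent (fun ij : 'I_n * 'I_m2 => xi ij.1 ij.2))
    (E U : T -> 'M[R]_(n, m2))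
    (hE : forall w i j, E w i j = sigma * xi i j w)
    (hU : forall w, U w = V *m A0 + E w)
    (Ahat : T -> 'M[R]_(m1, m2)),
  let r := \rank V in
  let gamma := (1 + beta) / (1 - alpha) in
  let lambda := (1 + beta) * (Num.sqrt m2%:R + Num.sqrt r%:R)
                / ((1 - alpha) * Num.sqrt (n * m2)%:R) in
  (forall w (A : 'M[R]_(m1, m2)),
     frobenius_norm (U w - V *m Ahat w) + lambda * nuclear_norm (V *m Ahat w)
     <= frobenius_norm (U w - V *m A) + lambda * nuclear_norm (V *m A)) ->
  (\rank (V *m A0))%:R
    <= rho ^+ 2 * n%:R * m2%:R
       / (2 * gamma ^+ 2 * (Num.sqrt m2%:R + Num.sqrt r%:R) ^+ 2) ->
  with_probability_at_least P (1 - 2 * expR (- (c * (m2 + r)%:R)))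
    [set w | frobenius_norm (V *m (Ahat w - A0)) ^+ 2
             <= C * sigma ^+ 2 * (m2 + r)%:R * (\rank (V *m A0))%:R].
Proof.
have a1 : 0 < 1 - alpha by rewrite subr_gt0.
have z0 : 0 < 1 - alpha / 2 by lra.
(* On the good event [|E| >= (1 - alpha / 2) sigma sqrt N], while [lambda] is set for the factor
   [1 - alpha]; [eta] is the ratio gained. *)
pose eta := (1 - alpha) / (1 - alpha / 2).
have eta0 : 0 <= eta by rewrite divr_ge0 ?ltW.
have eta1 : eta < 1 by rewrite ltr_pdivrMr// mul1r; lra.
pose K := 12 + 3 / (1 - eta).
have K0 : 0 < K by rewrite ltr_wpDr// divr_ge0// subr_ge0 ltW.
pose gam := (1 + beta) / (1 - alpha).
have gam0 : 0 < gam by rewrite divr_gt0// addr_gt0.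
(* The rates of the three bad events, expressed in [x = m2 + r] by [x <= t^2] and [x <= 2 N]. *)
pose c0 := Num.min (beta ^+ 2 / 8) (Num.min (alpha ^+ 2 / 16) (1 / 4)).
have c00 : 0 < c0 by rewrite !lt_min !divr_gt0 ?exprn_gt0.
have c01 : c0 <= beta ^+ 2 / 8 by rewrite ge_min lexx.
have c02 : c0 <= alpha ^+ 2 / 16 by rewrite !ge_min lexx orbT.
have c03 : c0 <= 1 / 4 by rewrite !ge_min lexx !orbT.
have [c [c_gt0 cP]] := rate_absorb c00.
(* The factor 8 comes from [(lambda e)^2 <= (2 sigma gam t)^2] and [t^2 <= 2 x]. *)
exists c, (8 * (K * gam) ^+ 2); split => //; split.
  by rewrite mulr_gt0// exprn_gt0// mulr_gt0.
move=> n m1 m2 hn hm1 hm2 V A0 sigma hsigma d T P xi hnormal hindep E U hE hU Ahat.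
move=> r gamma lambda hmin hrank.
pose t := Num.sqrt m2%:R + Num.sqrt r%:R : R.
have t0 : 0 < t by rewrite ltr_pwDl ?sqrtr_ge0// sqrtr_gt0 ltr0n.
pose x := (m2 + r)%:R : R.
have x1 : 1 <= x by rewrite ler1n addn_gt0 hm2.
have t2 : t ^+ 2 = x + 2 * (Num.sqrt m2%:R * Num.sqrt r%:R).
  rewrite sqrrD !sqr_sqrtr ?ler0n// /x natrD.
  ring.
have srt0 : 0 <= Num.sqrt m2%:R * Num.sqrt r%:R :> R by rewrite mulr_ge0 ?sqrtr_ge0.
have xt : x <= t ^+ 2 by rewrite t2; lra.
have tx : t ^+ 2 <= 2 * x.
  have := sqr_ge0 (Num.sqrt m2%:R - Num.sqrt r%:R : R).
  rewrite t2 sqrrB !sqr_sqrtr ?ler0n// /x natrD; lra.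
have rn : (r <= n)%N by exact: rank_leq_row.
pose N := (n * m2)%:R : R.
have N0 : 0 < N by rewrite ltr0n muln_gt0 hn.
have xN : x <= 2 * N.
  rewrite /x /N -natrM ler_nat mul2n -addnn leq_add ?leq_pmull//.
  by rewrite (leq_trans rn)// leq_pmulr.
have [F [mF PF FP]] := @gaussian_design_events _ _ _ P n m2 m1 V _ alpha beta hn hm2 halpha0 halpha1 hbeta
  (iid_gaussian_matrix hnormal hindep).
set y := (X in (_ <= X%:E)%E) in PF.
have yx : y <= (x + 2) * expR (- (c0 * x)).
  rewrite /y -/t -/N [(r + m2)%N]addnC -/x.
  have e1 : expR (- ((beta / 2 * t) ^+ 2 / 2)) <= expR (- (c0 * x)).
    rewrite ler_expR lerN2 (_ : (beta / 2 * t) ^+ 2 / 2 = beta ^+ 2 / 8 * t ^+ 2); last by field.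
    by apply: ler_pM => //; exact: ltW.
  have e2 : expR (- (N * (alpha / 2) ^+ 2 / 2)) <= expR (- (c0 * x)).
    rewrite ler_expR lerN2 (_ : N * (alpha / 2) ^+ 2 / 2 = alpha ^+ 2 / 16 * (2 * N)); last by field.
    by apply: ler_pM => //; exact: ltW.
  have e3 : expR (- (N / 2)) <= expR (- (c0 * x)).
    rewrite ler_expR lerN2 (_ : N / 2 = 1 / 4 * (2 * N)); last by field.
    by apply: ler_pM => //; exact: ltW.
  have := ler_wpM2l (le_trans ler01 x1) e1; lra.
(* When the claimed probability is not positive, the empty event suffices. *)
have [small|large] := ltP (2 * expR (- (c * x))) 1; last first.
  exists set0; split => //.
  by rewrite measure0 lee_fin subr_le0.
have y2 := cP x y x1 yx small.
exists (~` F); split; first exact: measurableC.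
  move=> w /= Fw.
  have [chi1 chi2 [M [MB EM]]] := FP w Fw.
  set Xi := \matrix_(i, j) _ in chi1 chi2 EM.
  have EX : E w = sigma *: Xi by apply/matrixP => i j; rewrite !mxE hE.
  pose e := Num.sqrt (fsq (E w)).
  have eE : e = sigma * Num.sqrt (fsq Xi).
    by rewrite /e EX /fsq ipZl ipZr mulrA -expr2 sqrtrM ?sqr_ge0// sqrtr_sqr gtr0_norm.
  have sN0 : 0 < Num.sqrt N by rewrite sqrtr_gt0.
  have Xi1 : (1 - alpha / 2) * Num.sqrt N <= Num.sqrt (fsq Xi).
    rewrite -[X in X * _](gtr0_norm z0) -sqrtr_sqr -sqrtrM ?sqr_ge0//.
    exact: ler_wsqrtr.
  have Xi2 : Num.sqrt (fsq Xi) <= 2 * Num.sqrt N.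
    rewrite -[X in _ <= X * _](@gtr0_norm _ 2)// -sqrtr_sqr -sqrtrM ?sqr_ge0//.
    by apply: ler_wsqrtr; rewrite (_ : 2 ^+ 2 = 4)//; ring.
  have lamE : lambda = gam * t / Num.sqrt N.
    rewrite /lambda -/t -/N /gam; field.
    by rewrite !gt_eqF.
  have lam0 : 0 < lambda by rewrite lamE divr_gt0// mulr_gt0.
  have e0 : 0 < e by rewrite eE mulr_gt0// (lt_le_trans _ Xi1)// mulr_gt0.
  have le1 : lambda * e <= 2 * (sigma * gam * t).
    rewrite eE lamE.
    rewrite (_ : 2 * _ = gam * t / Num.sqrt N * (sigma * (2 * Num.sqrt N))); last first.
      by field; rewrite gt_eqF.
    by apply: ler_wpM2l; [rewrite -lamE ltW|apply: ler_wpM2l => //; exact: ltW].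
  have MB' : op_bound (sigma * ((1 + beta) * t)) (sigma *: M).
    move=> u v; rewrite -scalemxAr -scalemxAl mxE mulrCA -[leRHS]mulrA.
    by rewrite ler_wpM2l ?(ltW hsigma).
  (* Inserting the rank assumption gives exactly [rho^2 / 2]. *)
  have lk : lambda ^+ 2 * (\rank (V *m A0))%:R <= 2^-1.
    apply: (@le_trans _ _ (lambda ^+ 2 * (rho ^+ 2 * n%:R * m2%:R / (2 * gamma ^+ 2 * t ^+ 2)))).
      by rewrite ler_wpM2l ?sqr_ge0.
    have -> : lambda ^+ 2 = gam ^+ 2 * t ^+ 2 / N.
      by rewrite lamE expr_div_n exprMn sqr_sqrtr// ltW.
    rewrite (_ : _ * _ = 2^-1 * rho ^+ 2); last first.
      rewrite /gamma -/gam /N natrM; field.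
      by rewrite !gt_eqF// ltr0n.
    by rewrite ler_piMr ?invr_ge0// exprn_ile1// ltW.
  have H := @estimator_bound R n m2 (V *m A0) (V *m (Ahat w - A0)) (E w) (sigma *: M)
    (sigma * ((1 + beta) * t)) lambda eta.
  rewrite frobenius_normE sqr_sqrtr ?fsq_ge0//.
  apply: le_trans (H _ lam0 eta0 eta1 e0 _ MB' _ lk _) _.
  - by rewrite !mulr_gt0// addr_gt0.
  - rewrite -/e eE lamE /eta /gam.
    have cancel (A Z q b : R) : A != 0 -> Z != 0 -> q != 0 ->
        sigma * (b * t) = A / Z * (b / A * t / q * (sigma * (Z * q))).
      by move=> A0' Z0' q0'; field; rewrite A0' Z0' q0'.
    rewrite (cancel (1 - alpha) (1 - alpha / 2) (Num.sqrt N)) ?gt_eqF//.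
    rewrite ler_wpM2l// ler_wpM2l ?ler_wpM2l ?(ltW hsigma)//.
    by rewrite -/gam -lamE ltW.
  - by rewrite EX !ipZl EM.
  - have -> : V *m A0 + V *m (Ahat w - A0) = V *m Ahat w by rewrite mulmxBr addrC subrK.
    have -> : E w - V *m (Ahat w - A0) = U w - V *m Ahat w.
      by rewrite hU mulmxBr opprB addrA [_ + E w]addrC.
    have <- : U w - V *m A0 = E w by rewrite hU addrAC subrr add0r.
    exact: hmin.
  rewrite -/K -/e ler_wpM2r// exprMn [(K * gam) ^+ 2]exprMn.
  have h2 : (lambda * e) ^+ 2 <= 8 * gam ^+ 2 * sigma ^+ 2 * x.
    apply: (@le_trans _ _ ((2 * (sigma * gam * t)) ^+ 2)).
      apply: lerXn2r => //; rewrite nnegrE; apply: ltW.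
        exact: mulr_gt0.
      by apply: mulr_gt0 => //; apply: mulr_gt0 => //; exact: mulr_gt0.
    rewrite (_ : _ ^+ 2 = 4 * gam ^+ 2 * sigma ^+ 2 * t ^+ 2); last by ring.
    rewrite (_ : _ * x = 4 * gam ^+ 2 * sigma ^+ 2 * (2 * x)); last by ring.
    apply: ler_wpM2l => //; apply: mulr_ge0; last exact: sqr_ge0.
    by apply: mulr_ge0 => //; exact: sqr_ge0.
  rewrite -/x (_ : 8 * _ * _ * x = K ^+ 2 * (8 * gam ^+ 2 * sigma ^+ 2 * x)); last by ring.
  by rewrite ler_wpM2l ?sqr_ge0.
have mFE : (P (~` F) = 1 - P F)%E by exact: probability_setC.
rewrite mFE EFinB leeB// (le_trans PF)// lee_fin.
Qed.
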